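(* Let $k,n\ge 0$ be integers, let $t\ge 0$, and set $y:=\sqrt{1-e^{-t}}$. Then the Weinstein function $\Lambda_k^{k+n}$ satisfies $$\Lambda_k^{k+n}(t)=\sum_{j=0}^{n}(2j+2k+1)\,\frac{4^{j+2k}\,((j+k)!)^2\,(n-j)!\,j!\,\big((1/2)_k\big)^2}{(2k+n+j+1)!\,(j+2k)!}\;e^{-(j+k)t}\,\Big(C_{j}^{k+1/2}(0)\Big)^2\Big(C_{n-j}^{j+k+1}\big(\sqrt{1-e^{-t}}\big)\Big)^2,$$ and therefore the Jacobi polynomial sum satisfies $$\sum_{j=0}^{n}P_j^{(2k,0)}(2y^2-1)=\sum_{j=0}^{n}(2j+2k+1)\,\frac{4^{j+2k}\,((j+k)!)^2\,(n-j)!\,j!\,\big((1/2)_k\big)^2}{(2k+n+j+1)!\,(j+2k)!}\;(1-y^2)^{j}\,\Big(C_{j}^{k+1/2}(0)\Big)^2\Big(C_{n-j}^{j+k+1}(y)\Big)^2 .$$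
   Context: Notation: $(a)_k=a(a+1)\cdots(a+k-1)$ is the shifted factorial, with $(a)_0=1$. $P_j^{(\alpha,\beta)}$ denotes the Jacobi polynomials and $C_n^\lambda$ ($\lambda>0$) the Gegenbauer polynomials, in standard normalization: $\sum_{n\ge0}C_n^\lambda(x)z^n=(1-2xz+z^2)^{-\lambda}$ and $P_j^{(\alpha,\beta)}(1)=\binom{j+\alpha}{j}$. Let $\mathbb{D}$ be the open unit disk and $K(z)=z/(1-z)^2$ the Koebe function, which maps $\mathbb{D}$ conformally onto $\mathbb{C}\setminus(-\infty,-1/4]$. For $z\in\mathbb{D}$ and $t\ge 0$ put $w(z,t)=K^{-1}\big(e^{-t}K(z)\big)\in\mathbb{D}$. For integers $0\le k\le n$, the Weinstein functions $\Lambda_k^n(t)$ are defined as the Taylor coefficients in $z$ in $$\frac{e^{t}\,w(z,t)^{k+1}}{1-w(z,t)^2}=\sum_{n=k}^{\infty}\Lambda_k^n(t)\,z^{n+1}\qquad(z\in\mathbb{D}).$$ *)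

(* Defs.v *)
From HB Require Import structures.
From mathcomp Require Import all_boot all_order all_algebra.
From mathcomp Require Import complex.
From mathcomp Require Import all_classical all_reals all_analysis.

Set Implicit Arguments.
Unset Strict Implicit.
Unset Printing Implicit Defensive.

Import Order.TTheory GRing.Theory Num.Theory.
Import numFieldNormedType.Exports.

Local Open Scope classical_set_scope.
Local Open Scope ring_scope.
Local Open Scope complex_scope.

(* Shifted factorial (a)_k = a (a + 1) ... (a + k - 1). *)
Definition shifted_fact (R : pzRingType) (a : R) (k : nat) : R :=
  \prod_(i < k) (a + i%:R).

(* Coefficient of z ^ n in the Taylor expansion of f at 0.  The derivative is
   the limit of difference quotients over K, hence the complex derivative for
   K = R[i]. *)
Definition taylor_coef (K : numFieldType) (f : K -> K) (n : nat) : K :=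
  derive1n n f 0 / n`!%:R.

(* C_n^lambda(x), from the generating function (1 - 2 x z + z ^ 2) ^ (-lambda);
   the base of the real power is positive for z near 0. *)
Definition gegenbauer (R : realType) (lambda : R) (n : nat) (x : R) : R :=
  taylor_coef (fun z : R => (1 - 2 * x * z + z ^+ 2) `^ (- lambda)) n.

(* P_n^(alpha,beta)(x) =
     (alpha + 1)_n / n! * 2F1(- n, n + alpha + beta + 1; alpha + 1; (1 - x) / 2)
   for alpha > -1; the value at x = 1 is
   (alpha + 1)_n / n! = binom(n + alpha, n). *)
Definition jacobi (R : realType) (alpha beta : R) (n : nat) (x : R) : R :=
  shifted_fact (alpha + 1) n / n`!%:R *
  \sum_(m < n.+1)
    shifted_fact (- n%:R) m * shifted_fact (n%:R + alpha + beta + 1) m /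
      (shifted_fact (alpha + 1) m * m`!%:R) * ((1 - x) / 2) ^+ m.

Section Weinstein.
Variable R : realType.

Definition unit_disk : set R[i] := [set z | `|z| < 1].

Definition koebe (z : R[i]) : R[i] := z / (1 - z) ^+ 2.

(* The inverse of the restriction of koebe to the unit disk, where koebe is
   injective; values outside the image of the disk are irrelevant. *)
Definition koebe_inv : R[i] -> R[i] := 'pinv_(fun=> 0) unit_disk koebe.

Definition koebe_flow (t : R) (z : R[i]) : R[i] :=
  koebe_inv ((expR (- t))%:C * koebe z).

(* Lambda_k^n(t), as the coefficient of z ^ (n + 1). *)
Definition weinstein (k n : nat) (t : R) : R[i] :=
  taylor_coef (fun z : R[i] =>
    (expR t)%:C * koebe_flow t z ^+ k.+1 / (1 - koebe_flow t z ^+ 2)) n.+1.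

End Weinstein.

(* Main.v *)
Require Import Defs.
From HB Require Import structures.
From mathcomp Require Import all_boot all_order all_algebra.
From mathcomp Require Import complex.
From mathcomp Require Import all_classical all_reals all_analysis.
From mathcomp Require Import ring lra zify.

(* Write s = e^(-t) = 1 - y^2.  Both sides of each identity are polynomials in s (times s^k
   for the Weinstein function), and they are compared coefficient by coefficient.
   - With rho(W) = sqrt(1 + 4 W), the root w of K(w) = W is (rho - 1) / (rho + 1), and
     w^(k+1) / (1 - w^2) = W * w^k / rho.  The Taylor coefficients of w^k / rho in W obey a
     first-order recurrence, and substituting W = s K(z) gives
     Lambda_k^(k+n) = s^k * sum_m (-1)^m C(2m+2k, m) C(n+2k+m+1, 2m+2k+1) s^m.
   - The same polynomial in s arises from the partial sums of the Jacobi polynomials, since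
     the sum over j of their m-th coefficients telescopes.
   - On the other side, Clausen's formula expands the square of a Gegenbauer polynomial in
     powers of 1 - y^2, and the coefficient of s^m becomes a terminating well-poised sum. *)

Set Implicit Arguments.
Unset Strict Implicit.
Unset Printing Implicit Defensive.

Import Order.TTheory GRing.Theory Num.Theory.
Import numFieldNormedType.Exports.

Local Open Scope ring_scope.
Local Open Scope complex_scope.

(** * Taylor coefficients at 0 *)

Section Smooth.
Local Open Scope classical_set_scope.
Variable K : numFieldType.
Implicit Types (f g : K -> K) (n : nat).

(** Taylor coefficients are defined by iterated derivatives, so every series manipulation has to be
    justified on germs at 0. The predicate [smooth0] carries this over any [numFieldType] and serves
    twice: over the reals for the Gegenbauer generating function, over [R[i]] for the Weinstein
    functions. No analyticity enters: the generating function and the square root rho each satisfy a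
    first-order differential equation near 0, which yields smoothness to every order and leads to
    recurrences for coefficients. The complex field matters mainly for the branch of the root: a
    positive real part of rho(z) rules out cancellation in rho(z) + rho(x), and this makes rho
    differentiable near 0. On the Gegenbauer side only even [j] contribute, because C_j(0) = 0 for
    odd [j]; hence the well-poised sum runs over i = j / 2. *)

Lemma nearW0 (P : K -> Prop) : (forall z, P z) -> \forall z \near (0 : K), P z.
Proof. by move=> HP; near=> z. Unshelve. all: by end_near. Qed.

(** The neighbourhood may shrink at each order. Derivability near 0, not only at 0, lets local
    identities be differentiated; nothing is asked elsewhere, which admits real powers and roots. *)
Fixpoint smooth0 n f : Prop :=
  if n is n'.+1 then (\forall z \near (0 : K), derivable f z 1) /\ smooth0 n' (derive1 f)
  else True.

Lemma derive1_near_eq f g :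
  (\forall z \near (0 : K), f z = g z) -> \forall z \near (0 : K), (derive1 f) z = (derive1 g) z.
Proof.
move=> /near_join; apply: filterS => z fg; rewrite !derive1E.
exact: near_eq_derive.
Qed.

Lemma smooth0_near_eq n f g :
  (\forall z \near (0 : K), f z = g z) -> smooth0 n f -> smooth0 n g.
Proof.
elim: n f g => [//|n IH] f g fg [df sf]; split; last first.
  by apply: IH sf; apply: derive1_near_eq.
by apply: filterS2 (near_join fg) df => z fgz; exact: near_eq_derivable.
Qed.

(** Lets the derivative be supplied by a formula valid near 0; most closure properties below go
    through it. *)
Lemma smooth0_intro n f g :
  (\forall z \near (0 : K), is_derive (z : K) 1 f (g z)) -> smooth0 n g -> smooth0 n.+1 f.
Proof.
move=> fg sg; split.
  by apply: filterS fg => z [].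
apply: smooth0_near_eq sg; apply: filterS fg => z [_ <-].
by rewrite derive1E.
Qed.

Lemma smooth0_is_derive n f : smooth0 n.+1 f ->
  \forall z \near (0 : K), is_derive (z : K) 1 f ((derive1 f) z).
Proof.
by case=> df _; apply: filterS df => z /derivableP; rewrite derive1E.
Qed.

Lemma smooth0W n f : smooth0 n.+1 f -> smooth0 n f.
Proof. by elim: n f => // n IH f [df /IH]. Qed.

Lemma smooth0_cst n c : smooth0 n (fun=> c).
Proof.
elim: n c => [//|n IH] c; apply: (@smooth0_intro _ _ (fun=> 0)) => //.
by apply: nearW0 => z; exact: is_derive_cst.
Qed.

Lemma smooth0_id n : smooth0 n (fun z => z).
Proof.
case: n => [//|n]; apply: (@smooth0_intro _ _ (fun=> 1)); last exact: smooth0_cst.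
by apply: nearW0 => z; exact: is_derive_id.
Qed.

Lemma smooth0D n f g : smooth0 n f -> smooth0 n g -> smooth0 n (fun z => f z + g z).
Proof.
elim: n f g => [//|n IH] f g sf sg.
apply: (@smooth0_intro _ _ (fun z => (derive1 f) z + (derive1 g) z)); last first.
  by apply: IH; [case: sf|case: sg].
near=> z; apply: is_deriveD.
  by near: z; apply: smooth0_is_derive sf.
by near: z; apply: smooth0_is_derive sg.
Unshelve. all: by end_near. Qed.

Lemma smooth0M n f g : smooth0 n f -> smooth0 n g -> smooth0 n (fun z => f z * g z).
Proof.
elim: n f g => [//|n IH] f g sf sg.
apply: (@smooth0_intro _ _ (fun z => (derive1 f) z * g z + f z * (derive1 g) z)); last first.
  apply: smooth0D; apply: IH.
  - by case: sf.
  - exact: smooth0W.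
  - exact: smooth0W.
  - by case: sg.
near=> z.
have df : is_derive (z : K) 1 f ((derive1 f) z) by near: z; apply: smooth0_is_derive sf.
have dg : is_derive (z : K) 1 g ((derive1 g) z) by near: z; apply: smooth0_is_derive sg.
by apply: is_derive_eq; rewrite addrC /GRing.scale/=; congr (_ + _); rewrite mulrC.
Unshelve. all: by end_near. Qed.

Lemma smooth0_continuous n f : smooth0 n.+1 f -> {for 0, continuous f}.
Proof.
case=> /nbhs_singleton df _.
by apply: differentiable_continuous; apply/derivable1_diffP.
Qed.

Lemma smooth0_neq0 n f : smooth0 n.+1 f -> f 0 != 0 ->
  \forall z \near (0 : K), f z != 0.
Proof. by move=> /smooth0_continuous cf f0; exact: cvgr_neq0 cf f0. Qed.

Lemma smooth0_comp_near n g (P : K -> Prop) : smooth0 n.+1 g -> g 0 = 0 ->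
  (\forall z \near (0 : K), P z) -> \forall z \near (0 : K), P (g z).
Proof. by move=> /smooth0_continuous cg g0 nP; apply: cg; rewrite g0. Qed.

Lemma smooth0N n f : smooth0 n f -> smooth0 n (fun z => - f z).
Proof.
move=> sf; apply: (@smooth0_near_eq _ (fun z => (-1) * f z)).
  by apply: nearW0 => z; rewrite mulN1r.
by apply: smooth0M => //; exact: smooth0_cst.
Qed.

Lemma smooth0B n f g : smooth0 n f -> smooth0 n g -> smooth0 n (fun z => f z - g z).
Proof. by move=> sf sg; apply: smooth0D => //; exact: smooth0N. Qed.

Lemma smooth0X n f m : smooth0 n f -> smooth0 n (fun z => f z ^+ m).
Proof.
move=> sf; elim: m => [|m IH].
  by apply: smooth0_near_eq (smooth0_cst n 1); apply: nearW0 => z; rewrite expr0.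
apply: (@smooth0_near_eq _ (fun z => f z * f z ^+ m)); last exact: smooth0M.
by apply: nearW0 => z; rewrite exprS.
Qed.

Lemma is_derive1V f z df : is_derive (z : K) 1 f df -> f z != 0 ->
  is_derive (z : K) 1 (fun x => (f x)^-1) (- (f z ^+ 2)^-1 * df).
Proof.
move=> [Df <-] fz; apply: DeriveDef; first exact: derivableV.
exact: deriveV.
Qed.

Lemma smooth0V n f : smooth0 n f -> f 0 != 0 -> smooth0 n (fun z => (f z)^-1).
Proof.
elim: n f => [//|n IH] f sf f0.
apply: (@smooth0_intro _ _ (fun z => - ((f z)^-1 * (f z)^-1) * (derive1 f) z)); last first.
  have sVf : smooth0 n (fun z => (f z)^-1) by apply: IH => //; exact: smooth0W.
  by apply: smooth0M; [apply: smooth0N; exact: smooth0M | case: sf].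
near=> z.
have df : is_derive (z : K) 1 f ((derive1 f) z) by near: z; apply: smooth0_is_derive sf.
have fz : f z != 0 by near: z; exact: smooth0_neq0 sf f0.
by rewrite -invfM -expr2; exact: is_derive1V.
Unshelve. all: by end_near. Qed.

Lemma is_derive1_comp f g z df dg : is_derive (g z : K) 1 f df -> is_derive (z : K) 1 g dg ->
  is_derive (z : K) 1 (fun x => f (g x)) (df * dg).
Proof.
move=> [/derivable1_diffP Df <-] [/derivable1_diffP Dg <-].
apply: DeriveDef.
  apply/derivable1_diffP.
  exact: (@differentiable_comp _ _ _ _ g f).
rewrite -!derive1E derive1E'; last exact/differentiable_comp.
rewrite diff_comp // !derive1E' //= -[X in 'd _ _ X = _]mulr1.
by rewrite [LHS]linearZ mulrC.
Qed.

Lemma smooth0_comp n f g : smooth0 n f -> smooth0 n g -> g 0 = 0 ->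
  smooth0 n (fun z => f (g z)).
Proof.
elim: n f g => [//|n IH] f g sf sg g0.
apply: (@smooth0_intro _ _ (fun z => (derive1 f) (g z) * (derive1 g) z)); last first.
  by apply: smooth0M; [apply: IH => //; [case: sf|exact: smooth0W] | case: sg].
have nf := smooth0_comp_near sg g0 (smooth0_is_derive sf).
by apply: filterS2 nf (smooth0_is_derive sg) => z ? ?; exact: is_derive1_comp.
Qed.

(** Bootstrapping: if [f] is smooth to order [n], so is f' = h f, hence [f] is smooth to order
    [n.+1]. *)
Lemma smooth0_ode f h : (\forall z \near (0 : K), is_derive (z : K) 1 f (h z * f z)) ->
  (forall n, smooth0 n h) -> forall n, smooth0 n f.
Proof.
move=> fh sh; elim=> [//|n IH].
by apply: smooth0_intro fh _; apply: smooth0M.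
Qed.

Lemma derive1n_near_eq n f g : (\forall z \near (0 : K), f z = g z) ->
  \forall z \near (0 : K), derive1n n f z = derive1n n g z.
Proof.
elim: n f g => [//|n IH] f g fg.
by rewrite !derive1Sn; apply: IH; exact: derive1_near_eq.
Qed.

Lemma taylor_coef_near_eq n f g : (\forall z \near (0 : K), f z = g z) ->
  taylor_coef f n = taylor_coef g n.
Proof.
by move=> /(derive1n_near_eq n)/nbhs_singleton fg; rewrite /taylor_coef fg.
Qed.

Lemma taylor_coef0 f : taylor_coef f 0 = f 0.
Proof. by rewrite /taylor_coef derive1n0 fact0 divr1. Qed.

Lemma taylor_coefS n f g : (\forall z \near (0 : K), is_derive (z : K) 1 f (g z)) ->
  taylor_coef f n.+1 = taylor_coef g n / n.+1%:R.
Proof.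
move=> fg; rewrite -[taylor_coef g n](@taylor_coef_near_eq n (derive1 f)).
  by rewrite /taylor_coef derive1Sn factS natrM invfM mulrA mulrAC.
by apply: filterS fg => z [_ <-]; rewrite derive1E.
Qed.

Lemma taylor_coef_derive n f : smooth0 n.+1 f ->
  taylor_coef (derive1 f) n = n.+1%:R * taylor_coef f n.+1.
Proof.
move=> /smooth0_is_derive /taylor_coefS ->.
by rewrite mulrC divfK// pnatr_eq0.
Qed.

Lemma taylor_coef_cst n (c : K) : taylor_coef (fun=> c) n = (n == 0)%:R * c.
Proof.
case: n c => [|n] c; first by rewrite taylor_coef0 mul1r.
rewrite (@taylor_coefS _ _ (fun=> 0)).
  elim: n => [|n IH]; first by rewrite taylor_coef0 !mul0r.
  rewrite (@taylor_coefS _ _ (fun=> 0)) ?IH ?mul0r//.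
  by apply: nearW0 => z; exact: is_derive_cst.
by apply: nearW0 => z; exact: is_derive_cst.
Qed.

Lemma taylor_coef_id n : taylor_coef (fun z : K => z) n = (n == 1)%:R.
Proof.
case: n => [|n]; first by rewrite taylor_coef0.
rewrite (@taylor_coefS _ _ (fun=> 1)).
  by rewrite taylor_coef_cst; case: n => [|n] /=; rewrite ?mul0r ?mulr1 ?divr1.
by apply: nearW0 => z; exact: is_derive_id.
Qed.

Lemma taylor_coefD n f g : smooth0 n f -> smooth0 n g ->
  taylor_coef (fun z => f z + g z) n = taylor_coef f n + taylor_coef g n.
Proof.
elim: n f g => [|n IH] f g sf sg; first by rewrite !taylor_coef0.
rewrite (@taylor_coefS _ _ (fun z => (derive1 f) z + (derive1 g) z)); last first.
  by apply: filterS2 (smooth0_is_derive sf) (smooth0_is_derive sg) => z ? ?; exact: is_deriveD.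
rewrite IH; [|by case: sf|by case: sg].
rewrite !taylor_coef_derive// -mulrDr mulrC mulKf// pnatr_eq0//.
Qed.

Lemma is_derive1M f g z df dg : is_derive (z : K) 1 f df -> is_derive (z : K) 1 g dg ->
  is_derive (z : K) 1 (fun x => f x * g x) (df * g z + f z * dg).
Proof.
move=> Df Dg.
by apply: is_derive_eq; rewrite addrC /GRing.scale/=; congr (_ + _); rewrite mulrC.
Qed.

Lemma taylor_coefM n f g : smooth0 n f -> smooth0 n g ->
  taylor_coef (fun z => f z * g z) n =
  \sum_(i < n.+1) taylor_coef f i * taylor_coef g (n - i).
Proof.
elim: n f g => [|n IH] f g sf sg.
  by rewrite big_ord_recl big_ord0 !taylor_coef0 addr0.
rewrite (@taylor_coefS _ _ (fun z => (derive1 f) z * g z + f z * (derive1 g) z)); last first.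
  by apply: filterS2 (smooth0_is_derive sf) (smooth0_is_derive sg) => z ? ?; exact: is_derive1M.
have sf' : smooth0 n (derive1 f) by case: sf.
have sg' : smooth0 n (derive1 g) by case: sg.
have sfn := smooth0W sf; have sgn := smooth0W sg.
rewrite taylor_coefD; [|exact: smooth0M|exact: smooth0M].
rewrite !IH//; apply: (canLR (mulfK _)); first by rewrite pnatr_eq0.
have sub m h : smooth0 n.+1 h -> (m <= n)%N -> smooth0 m.+1 h.
  move=> sh mn; have : (m.+1 <= n.+1)%N by []; elim: (n.+1) h sh => // p IHp h sh.
  by rewrite leq_eqVlt => /predU1P[->//|]; rewrite ltnS => /IHp; apply; exact: smooth0W.
rewrite [RHS]mulr_suml.
(* The weight n + 1 = i + (n + 1 - i) is split: the first part gives the coefficients of f' g, the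
   second those of f g'. *)
under [RHS]eq_bigr => i _.
  rewrite (_ : n.+1%:R = i%:R + (n.+1 - i)%:R); last by rewrite -natrD subnKC// -ltnS.
  rewrite mulrDr; over.
rewrite big_split/=; congr (_ + _).
  rewrite [RHS]big_ord_recl/= mulr0 add0r; apply: eq_bigr => i _.
  rewrite taylor_coef_derive; last by apply: sub => //; rewrite -ltnS.
  by rewrite /bump/= add1n subSS; ring.
rewrite [RHS]big_ord_recr/= subnn mulr0 addr0; apply: eq_bigr => i _.
rewrite taylor_coef_derive; last by apply: sub => //; rewrite leq_subr.
have in_ : (i <= n)%N by rewrite -ltnS.
by rewrite (subSn in_); ring.
Qed.

End Smooth.

(** * Shifts, powers and compositions *)

Section TaylorComposition.
Local Open Scope classical_set_scope.
Variable K : numFieldType.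
Implicit Types (f g : K -> K) (n : nat).

Lemma taylor_coefZ n f c : smooth0 n f ->
  taylor_coef (fun z => c * f z) n = c * taylor_coef f n.
Proof.
move=> sf; rewrite taylor_coefM//; last exact: smooth0_cst.
rewrite big_ord_recl/= subn0 taylor_coef_cst mul1r big1 ?addr0// => i _.
by rewrite taylor_coef_cst !mul0r.
Qed.

Lemma taylor_coefXM n f : smooth0 n.+1 f ->
  taylor_coef (fun z => z * f z) n.+1 = taylor_coef f n.
Proof.
move=> sf; rewrite taylor_coefM//; last exact: smooth0_id.
rewrite !big_ord_recl/= !taylor_coef_id mul0r add0r mul1r subn1 big1 ?addr0// => i _.
by rewrite taylor_coef_id mul0r.
Qed.

Lemma taylor_coefXnM m n f : (forall n, smooth0 n f) ->
  taylor_coef (fun z => z ^+ m * f z) n =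
  if (n < m)%N then 0 else taylor_coef f (n - m).
Proof.
move=> sf; elim: m n => [|m IH] n.
  by rewrite ltn0 subn0; apply: taylor_coef_near_eq; apply: nearW0 => z; rewrite mul1r.
rewrite (@taylor_coef_near_eq _ _ _ (fun z => z * (z ^+ m * f z))); last first.
  by apply: nearW0 => z; rewrite exprS mulrA.
case: n => [|n]; first by rewrite taylor_coef0 mul0r.
rewrite taylor_coefXM ?IH//; apply: smooth0M => //; apply: smooth0X; exact: smooth0_id.
Qed.

Lemma is_derive1X f m z df : is_derive (z : K) 1 f df ->
  is_derive (z : K) 1 (fun x => f x ^+ m.+1) (m.+1%:R * (f z ^+ m * df)).
Proof.
move=> Df; elim: m => [|m IH].
  by apply: is_derive_eq Df _; rewrite expr0 !mul1r.
rewrite (_ : (fun x => _) = (fun x => f x * f x ^+ m.+1)).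
  by apply: is_derive_eq (is_derive1M Df IH) _; rewrite -(natr1 m.+1) exprS; ring.
by apply/funext => x; rewrite exprS.
Qed.

(** The chain rule for powers, in coefficients; it replaces Faa di Bruno's formula in the proof of
    [taylor_coef_comp]. *)
Lemma taylor_coefX_derive f m n : (forall n, smooth0 n f) ->
  n.+1%:R * taylor_coef (fun z => f z ^+ m.+1) n.+1 =
  m.+1%:R * \sum_(j < n.+1) taylor_coef (fun z => f z ^+ m) j * taylor_coef (derive1 f) (n - j).
Proof.
move=> sf.
have sf' k : smooth0 k (derive1 f) by case: (sf k.+1).
rewrite (@taylor_coefS _ _ _ (fun z => m.+1%:R * (f z ^+ m * derive1 f z))); last first.
  by apply: filterS (smooth0_is_derive (sf 1)) => z; exact: is_derive1X.
rewrite mulrC divfK ?pnatr_eq0//.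
rewrite taylor_coefZ; last by apply: smooth0M => //; exact: smooth0X.
by rewrite taylor_coefM//; exact: smooth0X.
Qed.

Lemma taylor_coefX_lt f m n : (forall n, smooth0 n f) -> f 0 = 0 -> (n < m)%N ->
  taylor_coef (fun z => f z ^+ m) n = 0.
Proof.
move=> sf f0; elim: m n => [//|m IH] [|n] nm.
  by rewrite taylor_coef0 f0 expr0n.
apply: (@mulfI _ n.+1%:R); first by rewrite pnatr_eq0.
rewrite taylor_coefX_derive// big1 ?mulr0// => j _.
by rewrite IH ?mul0r//; have := ltn_ord j; rewrite ltnS => /leq_ltn_trans; apply.
Qed.

(** The sum is finite because g(0) = 0 makes g^m vanish to order m. In (f o g)' = (f' o g) g' the
    induction hypothesis expands f' o g, and [taylor_coefX_derive] reassembles g^m g' into the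
    derivative of g^(m+1). *)
Lemma taylor_coef_comp f g n : (forall n, smooth0 n f) -> (forall n, smooth0 n g) ->
  g 0 = 0 ->
  taylor_coef (fun z => f (g z)) n =
  \sum_(m < n.+1) taylor_coef f m * taylor_coef (fun z => g z ^+ m) n.
Proof.
move=> + sg g0.
elim/ltn_ind: n f => -[|n] IH f sf.
  by rewrite big_ord_recl big_ord0 !taylor_coef0 g0 expr0 mulr1 addr0.
have sg' k : smooth0 k (derive1 g) by case: (sg k.+1).
have sf' k : smooth0 k (derive1 f) by case: (sf k.+1).
rewrite (@taylor_coefS _ _ _ (fun z => (derive1 f) (g z) * (derive1 g) z)); last first.
  have nf := smooth0_comp_near (sg 1) g0 (smooth0_is_derive (sf 1)).
  by apply: filterS2 nf (smooth0_is_derive (sg 1)) => z ? ?; exact: is_derive1_comp.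
apply: (canLR (mulfK _)); first by rewrite pnatr_eq0.
rewrite taylor_coefM//; last exact: smooth0_comp.
rewrite [X in _ = X * _]big_ord_recl.
have -> : taylor_coef (fun z => g z ^+ (ord0 : 'I_n.+2)) n.+1 = 0.
  by rewrite (@taylor_coef_near_eq _ _ _ (fun=> 1)) ?taylor_coef_cst ?mul0r//; apply: nearW0.
rewrite mulr0 add0r mulr_suml.
transitivity (\sum_(i < n.+1) \sum_(m < n.+1) taylor_coef (derive1 f) m *
    taylor_coef (fun z => g z ^+ m) i * taylor_coef (derive1 g) (n - i)).
  apply: eq_bigr => i _; rewrite IH// mulr_suml.
  have hi : (i.+1 <= n.+1)%N by [].
  (* The range of [m] is made independent of [i], so that the sums can be exchanged; the added terms
     vanish by [taylor_coefX_lt]. *)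
  rewrite (big_ord_widen n.+1 (fun m => taylor_coef (derive1 f) m *
    taylor_coef (fun z => g z ^+ m) i * taylor_coef (derive1 g) (n - i)) hi).
  rewrite big_mkcond/=; apply: eq_bigr => m _.
  case: ltnP => // im; rewrite taylor_coefX_lt ?mulr0 ?mul0r//.
rewrite exchange_big/=; apply: eq_bigr => m _.
under eq_bigr do rewrite -mulrA.
rewrite -mulr_sumr taylor_coef_derive//.
have E := taylor_coefX_derive m n sg.
by rewrite /bump/= add1n -[RHS]mulrA [_ * n.+1%:R]mulrC E; ring.
Qed.

End TaylorComposition.

(** * Gegenbauer polynomials *)

Section Gegenbauer.
Local Open Scope classical_set_scope.
Variable R : realType.
Implicit Types (l x : R).

Let q x (z : R) := 1 - 2 * x * z + z ^+ 2.

Let smooth_q x n : smooth0 n (q x).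
Proof.
apply: smooth0D; last by apply: smooth0X; exact: smooth0_id.
apply: smooth0B; first exact: smooth0_cst.
by apply: smooth0M; [exact: smooth0_cst | exact: smooth0_id].
Qed.

Let q0 x : q x 0 = 1. Proof. by rewrite /q mulr0 subr0 expr0n addr0. Qed.

Let q_gt0 x : \forall z \near (0 : R), 0 < q x z.
Proof.
have := smooth0_continuous (smooth_q x 1); rewrite /prop_for /continuous_at q0 => cq.
exact: (cvgr_gt _ cq).
Qed.

Let is_derive_q x z : is_derive (z : R) 1 (q x) (2 * z - 2 * x).
Proof.
apply: is_derive_eq.
by rewrite /GRing.scale/=; ring.
Qed.

Let gen l x := fun z => (1 - 2 * x * z + z ^+ 2) `^ (- l).

Let gen_derive l x : \forall z \near (0 : R),
  is_derive (z : R) 1 (gen l x) (2 * l * (x - z) * (q x z)^-1 * gen l x z).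
Proof.
apply: filterS (q_gt0 x) => z q0z.
have D := is_derive1_comp (is_derive1_powR (- l) q0z) (is_derive_q x z).
apply: is_derive_eq D _.
rewrite powRB; last by rewrite (lt0r_neq0 q0z) implybT.
by rewrite powRr1 ?(ltW q0z)// /gen -/(q x z); ring.
Qed.

Let smooth_gen l x n : smooth0 n (gen l x).
Proof.
move: n; apply: smooth0_ode (gen_derive l x) _ => n.
apply: smooth0M; last by apply: smooth0V; rewrite ?q0 ?oner_eq0.
apply: smooth0M; first exact: smooth0_cst.
by apply: smooth0B; [exact: smooth0_cst | exact: smooth0_id].
Qed.

Lemma gegenbauer0 l x : gegenbauer l 0 x = 1.
Proof. by rewrite /gegenbauer taylor_coef0 mulr0 subr0 expr0n addr0 powR1. Qed.

(** Clears the denominator in G' = 2 l (x - z) G / (1 - 2 x z + z^2). Powers of z are kept as nested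
    factors so that [taylor_coefXM] shifts one step at a time. *)
Let gen_ode l x : \forall z \near (0 : R),
  derive1 (gen l x) z + (z * (-2 * x * derive1 (gen l x) z)
   + z * (z * derive1 (gen l x) z)) =
  2 * l * x * gen l x z + z * (- 2 * l * gen l x z).
Proof.
apply: filterS2 (q_gt0 x) (gen_derive l x) => z q0z [_]; rewrite -derive1E => ->.
have : q x z != 0 by rewrite gt_eqF.
by rewrite /q => ?; field.
Qed.

Lemma gegenbauer1 l x : gegenbauer l 1 x = 2 * l * x.
Proof.
rewrite /gegenbauer -/(gen l x); have := taylor_coef_near_eq 0 (gen_ode l x).
rewrite !taylor_coef0 !mul0r !addr0 => H.
rewrite (@taylor_coefS _ _ _ (derive1 (gen l x))); last first.
  exact: smooth0_is_derive (smooth_gen l x 1).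
rewrite taylor_coef0 divr1 H.
by have := gegenbauer0 l x; rewrite /gegenbauer taylor_coef0 /gen => ->; rewrite mulr1.
Qed.

Lemma gegenbauer_rec l x n :
  n.+2%:R * gegenbauer l n.+2 x =
  2 * x * (n.+1%:R + l) * gegenbauer l n.+1 x - (n%:R + 2 * l) * gegenbauer l n x.
Proof.
rewrite /gegenbauer -/(gen l x); have := taylor_coef_near_eq n.+1 (gen_ode l x).
have sg := smooth_gen l x.
have sg' k : smooth0 k (derive1 (gen l x)) by case: (sg k.+1).
have sz k : smooth0 k (fun z => z * derive1 (gen l x) z).
  by apply: smooth0M => //; exact: smooth0_id.
have sz' k : smooth0 k (fun z => (-2 * x) * derive1 (gen l x) z).
  by apply: smooth0M => //; exact: smooth0_cst.
have szc k c : smooth0 k (fun z => c * gen l x z).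
  by apply: smooth0M => //; exact: smooth0_cst.
rewrite taylor_coefD//; last first.
  by apply: smooth0D; apply: smooth0M => //; exact: smooth0_id.
rewrite taylor_coefD//; [|by apply: smooth0M => //; exact: smooth0_id..].
rewrite !taylor_coefXM// taylor_coefD//; last by apply: smooth0M => //; exact: smooth0_id.
rewrite !taylor_coefXM// !taylor_coefZ// !taylor_coef_derive//.
have -> : taylor_coef (fun z => z * derive1 (gen l x) z) n = n%:R * taylor_coef (gen l x) n.
  case: n => [|n]; first by rewrite taylor_coef0 !mul0r.
  by rewrite taylor_coefXM// taylor_coef_derive.
rewrite -[n.+1%:R]natr1; lra.
Qed.

Lemma gegenbauer_odd_at0 l i : gegenbauer l i.*2.+1 0 = 0.
Proof.
elim: i => [|i IH]; first by rewrite gegenbauer1 mulr0.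
apply: (@mulfI _ (i.*2.+3)%:R); first by rewrite pnatr_eq0.
by rewrite doubleS gegenbauer_rec IH !(mulr0, mul0r) subr0.
Qed.

Lemma gegenbauer_even_at0 l i :
  gegenbauer l i.*2 0 = (-1) ^+ i * shifted_fact l i / i`!%:R.
Proof.
elim: i => [|i IH].
  by rewrite gegenbauer0 /shifted_fact big_ord0 fact0 expr0 !mul1r invr1.
apply: (@mulfI _ (i.*2.+2)%:R); first by rewrite pnatr_eq0.
rewrite doubleS gegenbauer_rec IH !(mulr0, mul0r) sub0r.
rewrite /shifted_fact big_ord_recr/= factS natrM exprS.
rewrite (_ : i.*2.+2%:R = i.+1%:R * 2 :> R); last by rewrite -natrM muln2.
rewrite (_ : i.*2%:R = i%:R * 2 :> R); last by rewrite -natrM muln2.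
have fi : i`!%:R != 0 :> R by rewrite pnatr_eq0 -lt0n fact_gt0.
have i1 : i.+1%:R != 0 :> R by rewrite pnatr_eq0.
by field; rewrite fi nat1r.
Qed.

End Gegenbauer.

(** * Clausen's formula for squares of Gegenbauer polynomials *)

Section GegenbauerSquare.
Variable R : realType.
Implicit Types (l x : R).

Lemma shifted_fact0 l : shifted_fact l 0 = 1.
Proof. by rewrite /shifted_fact big_ord0. Qed.

Lemma shifted_factS l k : shifted_fact l k.+1 = shifted_fact l k * (l + k%:R).
Proof. by rewrite /shifted_fact big_ord_recr. Qed.

Lemma shifted_fact_gt0 l k : 0 < l -> 0 < shifted_fact l k.
Proof.
by move=> l0; apply: prodr_gt0 => i _; rewrite ltr_wpDr.
Qed.

(** Coefficients of ((2l)_n / n!)^2 3F2(-n, n + 2l, l; 2l, l + 1/2; s). The test on [m] stands for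
    the vanishing of (-n)_m when m > n, where the truncated [n - m] would give the factorial 1. *)
Definition gegenbauer_sq_coef l n m : R :=
  if (m <= n)%N then
    (-1) ^+ m * (shifted_fact (2 * l) n * shifted_fact (2 * l) (n + m) * shifted_fact l m) /
    (n`!%:R * (n - m)`!%:R * shifted_fact (2 * l) m * shifted_fact (l + 2^-1) m * m`!%:R)
  else 0.

Local Notation a := gegenbauer_sq_coef.

Let fact_neq0 k : k`!%:R != 0 :> R.
Proof. by rewrite pnatr_eq0 -lt0n fact_gt0. Qed.

(** This shift relation and the next are kept free of division: a factor vanishes exactly where one
    coefficient has left the support and the other has not, so they hold for every [m]. *)
Lemma gegenbauer_sq_coefSl l n m : 0 < l ->
  (n.+1)%:R * (n.+1%:R - m%:R) * a l n.+1 m =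
  (n%:R + 2 * l) * (n%:R + m%:R + 2 * l) * a l n m.
Proof.
move=> l0; rewrite /a; case: (leqP m n) => mn; last first.
  rewrite mulr0; case: (leqP m n.+1) => mn'; last by rewrite mulr0.
  have -> : m = n.+1 by apply/eqP; rewrite eqn_leq mn' mn.
  by rewrite subrr mulr0 mul0r.
rewrite leqW// subSn// addSn !factS !natrM !shifted_factS.
rewrite (_ : n.+1%:R - m%:R = (n - m).+1%:R); last by rewrite -natrB ?subSn// leqW.
rewrite natrD.
have /lt0r_neq0 ? : 0 < shifted_fact (2 * l) m by apply: shifted_fact_gt0; rewrite mulr_gt0.
have /lt0r_neq0 ? : 0 < shifted_fact (l + 2^-1) m.
  by apply: shifted_fact_gt0; rewrite addr_gt0// invr_gt0.
have := fact_neq0 n; have := fact_neq0 m; have := fact_neq0 (n - m) => ? ? ?.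
by field; repeat (apply/andP; split => //).
Qed.

Lemma gegenbauer_sq_coefSr l n m : 0 < l ->
  m.+1%:R * (2 * l + m%:R) * (l + 2^-1 + m%:R) * a l n m.+1 =
  - (n%:R - m%:R) * (n%:R + m%:R + 2 * l) * (l + m%:R) * a l n m.
Proof.
move=> l0; rewrite /a; case: (leqP m n) => mn; last first.
  by rewrite leqNgt ltnS ltnW//= !mulr0.
move: mn; rewrite leq_eqVlt => /predU1P[->|mn]; first by rewrite ltnn subrr oppr0 !(mul0r,mulr0).
rewrite mn addnS !factS !natrM !shifted_factS.
rewrite (_ : (n - m)%N = (n - m.+1).+1); last by rewrite subnS prednK// subn_gt0.
rewrite factS natrM exprS (_ : n%:R - m%:R = (n - m.+1).+1%:R); last first.
  by rewrite -natrB ?(ltnW mn)// subnS prednK// subn_gt0.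
rewrite natrD.
have /lt0r_neq0 ? : 0 < shifted_fact (2 * l) m by apply: shifted_fact_gt0; rewrite mulr_gt0.
have /lt0r_neq0 ? : 0 < shifted_fact (l + 2^-1) m.
  by apply: shifted_fact_gt0; rewrite addr_gt0// invr_gt0.
have := fact_neq0 n; have := fact_neq0 m; have := fact_neq0 (n - m.+1) => ? ? ?.
have m0 : 0 <= m%:R :> R by [].
have ? : 2 * l + m%:R != 0 by lra.
have ? : l + 2^-1 + m%:R != 0 by lra.
have ? : l * 2 + 1 + m%:R * 2 != 0 by lra.
by field; repeat (apply/andP; split => //).
Qed.

Lemma gegenbauer_sq_coef_gt l n m : (n < m)%N -> a l n m = 0.
Proof. by move=> nm; rewrite /a leqNgt nm. Qed.

Definition gegenbauer_sq_poly l n : {poly R} := \poly_(m < n.+1) a l n m.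

(** Candidate for the quotient of C_{n+1} C_n, which is odd in x, by x, as a polynomial in 1 - x^2;
    confirmed in [sq_and_adj]. *)
Definition gegenbauer_adj_poly l n : {poly R} :=
  \poly_(m < n.+1) ((n%:R + m%:R + 2 * l) * a l n m / n.+1%:R).

Lemma coef_gegenbauer_sq_poly l n m : (gegenbauer_sq_poly l n)`_m = a l n m.
Proof.
rewrite coef_poly; case: leqP => // nm.
by rewrite gegenbauer_sq_coef_gt.
Qed.

Lemma coef_gegenbauer_adj_poly l n m :
  (gegenbauer_adj_poly l n)`_m = (n%:R + m%:R + 2 * l) * a l n m / n.+1%:R.
Proof.
rewrite coef_poly; case: leqP => // nm.
by rewrite gegenbauer_sq_coef_gt// mulr0 mul0r.
Qed.

Local Notation A := gegenbauer_sq_poly.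
Local Notation B := gegenbauer_adj_poly.

(** Mirrors the three-term recurrence for C_{n+2}, multiplied by C_{n+1} and divided by x. *)
Lemma gegenbauer_adj_poly_rec l n : 0 < l ->
  n.+2%:R *: B l n.+1 = (2 * (n.+1%:R + l)) *: A l n.+1 - (n%:R + 2 * l) *: B l n.
Proof.
move=> l0; apply/polyP => m; rewrite !(coefB, coefZ).
rewrite !coef_gegenbauer_adj_poly coef_gegenbauer_sq_poly.
have E := gegenbauer_sq_coefSl n m l0.
have n1 : n.+1%:R != 0 :> R by rewrite pnatr_eq0.
have n2 : n.+2%:R != 0 :> R by rewrite pnatr_eq0.
rewrite [LHS]mulrC divfK//.
apply: (mulfI n1).
rewrite mulrBr [X in _ = _ - X](_ : _ = n.+1%:R * (n.+1%:R - m%:R) * a l n.+1 m); first ring.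
by rewrite E; field; rewrite nat1r.
Qed.

(** Coefficient form of [gegenbauer_sq_poly_rec]; the case on [m] is the shift caused by the factor
    1 - X. For m <= n + 1 every coefficient is a rational multiple of [a l n.+1 m], which leaves one
    rational identity. *)
Lemma gegenbauer_sq_coef_rec l n m : 0 < l ->
  n.+2%:R ^+ 2 * a l n.+2 m =
  4 * (n.+1%:R + l) * ((m%:R + l) * a l n.+1 m -
     (if m is m'.+1 then (m'%:R + l) * a l n.+1 m' else 0)) +
  (n%:R + 2 * l) ^+ 2 * a l n m.
Proof.
move=> l0.
have n0 : 0 <= n%:R :> R by [].
have E1 := gegenbauer_sq_coefSl n.+1 m l0.
have E2 := gegenbauer_sq_coefSl n m l0.
have n1 : n.+1%:R = n%:R + 1 :> R by rewrite natr1.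
have n2 : n.+2%:R = n%:R + 2 :> R by rewrite -natrD addn2.
have [mn|] := leqP m n.+1.
  have mnR : m%:R <= n%:R + 1 :> R by rewrite natr1 ler_nat.
  have m0 : 0 <= m%:R :> R by [].
  have -> : (if m is m'.+1 then (m'%:R + l) * a l n.+1 m' else 0) =
     - (m%:R * (2 * l + m%:R - 1) * (l + m%:R - 2^-1)) /
     ((n%:R + 2 - m%:R) * (n%:R + 2 * l + m%:R)) * a l n.+1 m.
    case: m {E1 E2 m0} mn mnR => [|m] mn mnR; first by rewrite mulr0n !mul0r oppr0 !mul0r.
    have m0 : 0 <= m%:R :> R by [].
    have E := gegenbauer_sq_coefSr n.+1 m l0.
    rewrite -natr1 in E mnR *; rewrite n1 in E.
    have d1 : n%:R + 2 - (m%:R + 1) != 0 :> R by lra.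
    have d2 : n%:R + 2 * l + (m%:R + 1) != 0 :> R by lra.
    apply: (mulfI d1); apply: (mulfI d2).
    transitivity (- ((m%:R + 1) * (2 * l + m%:R) * (l + 2^-1 + m%:R) * a l n.+1 m.+1)).
      by rewrite E; ring.
    by field; rewrite d1 d2.
  have d1 : n%:R + 2 - m%:R != 0 :> R by lra.
  have d2 : n%:R + m%:R + 2 * l != 0 :> R by lra.
  have d3 : n%:R + 2 * l != 0 :> R by lra.
  have d4 : n%:R + 2 != 0 :> R by lra.
  have -> : a l n.+2 m = (n%:R + 1 + 2 * l) * (n%:R + 1 + m%:R + 2 * l) /
      ((n%:R + 2) * (n%:R + 2 - m%:R)) * a l n.+1 m.
    rewrite n2 n1 in E1.
    by apply: (mulfI d4); apply: (mulfI d1); transitivity ((n%:R + 2) * (n%:R + 2 - m%:R) * a l n.+2 m);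
      [ring | rewrite E1; field; rewrite d1 d4].
  have -> : a l n m = (n%:R + 1) * (n%:R + 1 - m%:R) /
      ((n%:R + 2 * l) * (n%:R + m%:R + 2 * l)) * a l n.+1 m.
    rewrite n1 in E2.
    by apply: (mulfI d3); apply: (mulfI d2); transitivity ((n%:R + 2 * l) * (n%:R + m%:R + 2 * l) * a l n m);
      [ring | rewrite -E2; field; rewrite d2 d3].
  rewrite n1 n2; field.
  by rewrite d1 d2 d3 d4 ?andbT//=; lra.
(* Edge of the support: at index n + 2 the former unit is zero, so [a l n.+1 n.+1] takes its place;
   beyond that index all terms vanish. *)
case: m E1 E2 => [//|m] E1 E2; rewrite ltnS => nm.
rewrite (gegenbauer_sq_coef_gt _ (_ : n.+1 < m.+1)%N)// (gegenbauer_sq_coef_gt _ (_ : n < m.+1)%N) 1?ltnW//.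
move: nm; rewrite leq_eqVlt => /predU1P[nm|nm]; last first.
  by rewrite !gegenbauer_sq_coef_gt// !mulr0 subrr mulr0 addr0.
have {E1 E2} E1 := gegenbauer_sq_coefSl n.+1 m l0.
have E2 := gegenbauer_sq_coefSr n.+2 m l0.
rewrite -{m}nm n2 n1 in E1 E2 *.
rewrite !mulr0 addr0 sub0r.
have d1 : 2 * l + (n%:R + 1) != 0 by lra.
have d2 : l + 2^-1 + (n%:R + 1) != 0 by lra.
have d4 : n%:R + 2 != 0 :> R by lra.
have -> : a l n.+2 n.+2 = - (2 * n%:R + 3 + 2 * l) * (l + n%:R + 1) /
   ((n%:R + 2) * (2 * l + (n%:R + 1)) * (l + 2^-1 + (n%:R + 1))) * a l n.+2 n.+1.
  apply: (mulfI d4); apply: (mulfI d1); apply: (mulfI d2).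
  transitivity ((n%:R + 2) * (2 * l + (n%:R + 1)) * (l + 2^-1 + (n%:R + 1)) * a l n.+2 n.+2); first ring.
  by rewrite E2; field; rewrite d1 d4/=; lra.
have -> : a l n.+2 n.+1 = (n%:R + 1 + 2 * l) * (2 * n%:R + 2 + 2 * l) / (n%:R + 2) * a l n.+1 n.+1.
  apply: (mulfI d4).
  transitivity ((n%:R + 2) * (n%:R + 2 - (n%:R + 1)) * a l n.+2 n.+1); first ring.
  by rewrite E1; field.
by field; rewrite d1 d4/=; lra.
Qed.


(** With P = (n + 2) C_{n+2}, u = 2 x (n + 1 + l) C_{n+1} and v = (n + 2l) C_n, the recurrence P = u
    - v gives P^2 = u (P - v) + v^2, which involves only squares and consecutive products. The
    resulting x^2 becomes 1 - X. *)
Lemma gegenbauer_sq_poly_rec l n : 0 < l ->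
  (n.+2%:R ^+ 2) *: A l n.+2 =
  (2 * (n.+1%:R + l)) *: ((1 - 'X) * (n.+2%:R *: B l n.+1 - (n%:R + 2 * l) *: B l n)) +
  ((n%:R + 2 * l) ^+ 2) *: A l n.
Proof.
move=> l0.
have D m : (n.+2%:R *: B l n.+1 - (n%:R + 2 * l) *: B l n)`_m = 2 * ((m%:R + l) * a l n.+1 m).
  rewrite coefB !coefZ !coef_gegenbauer_adj_poly.
  have E := gegenbauer_sq_coefSl n m l0.
  have n1 : n.+1%:R != 0 :> R by rewrite pnatr_eq0.
  have n2 : n.+2%:R != 0 :> R by rewrite pnatr_eq0.
  rewrite [_ / n.+2%:R]mulrC mulVKf//; apply: (mulfI n1).
  rewrite mulrBr [X in _ - X = _](_ : _ = n.+1%:R * (n.+1%:R - m%:R) * a l n.+1 m); first ring.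
  by rewrite E; field; rewrite nat1r.
apply/polyP => m; rewrite coefZ coef_gegenbauer_sq_poly gegenbauer_sq_coef_rec//.
rewrite coefD !coefZ coef_gegenbauer_sq_poly; congr (_ + _).
rewrite mulrBl mul1r coefB coefXM !D; case: m => [|m]/=; first ring.
by ring.
Qed.

(* The product of consecutive polynomials is carried along so that the three-term recurrence
   closes the induction. *)
Let sq_and_adj l x n : 0 < l ->
  [/\ (gegenbauer l n x) ^+ 2 = (A l n).[1 - x ^+ 2],
      (gegenbauer l n.+1 x) ^+ 2 = (A l n.+1).[1 - x ^+ 2] &
      gegenbauer l n.+1 x * gegenbauer l n x = x * (B l n).[1 - x ^+ 2]].
Proof.
move=> l0; elim: n => [|n [S0 S1 P]].
  have ? : 2 * l != 0 by lra.
  have ? : 2 * l + 1 != 0 by lra.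
  have ? : l + 2^-1 != 0 by lra.
  rewrite gegenbauer0 gegenbauer1 !horner_poly !big_ord_recl !big_ord0 /=.
  rewrite /a/= /bump/= !shifted_factS !shifted_fact0 !fact0.
  rewrite ?addn0 ?subn0 ?factS ?fact0 ?muln1; split; [by field|by field; repeat (apply/andP; split => //); lra|by field].
have n2 : n.+2%:R != 0 :> R by rewrite pnatr_eq0.
have rec := gegenbauer_rec l x n.
have P' : gegenbauer l n.+2 x * gegenbauer l n.+1 x = x * (B l n.+1).[1 - x ^+ 2].
  apply: (mulfI n2); rewrite [RHS]mulrCA -[n.+2%:R * _.[_]]hornerZ gegenbauer_adj_poly_rec//.
  by rewrite hornerD hornerN !hornerZ -S1 mulrA rec mulrBr [x * (_ * (B l n).[_])]mulrCA -P; ring.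
split => //.
apply: (mulfI (expf_neq0 2 n2)); rewrite -hornerZ gegenbauer_sq_poly_rec//.
rewrite hornerD !hornerZ hornerM !hornerD !hornerN hornerX hornerC !hornerZ -S0.
rewrite (_ : _ ^+ 2 * _ = n.+2%:R * gegenbauer l n.+2 x * (n.+2%:R * gegenbauer l n.+2 x)); last ring.
rewrite {1}rec mulrBl.
rewrite [X in X - _ = _](_ : _ = 2 * x * (n.+1%:R + l) * n.+2%:R *
   (gegenbauer l n.+2 x * gegenbauer l n.+1 x)); last ring.
rewrite P' {}rec.
rewrite [X in _ - X = _](_ : _ = (n%:R + 2 * l) * 2 * x * (n.+1%:R + l) *
   (gegenbauer l n.+1 x * gegenbauer l n x) - ((n%:R + 2 * l) * gegenbauer l n x) ^+ 2); last ring.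
by rewrite P; ring.
Qed.

Lemma gegenbauer_sqE l n x : 0 < l -> (gegenbauer l n x) ^+ 2 =
  \sum_(m < n.+1) gegenbauer_sq_coef l n m * (1 - x ^+ 2) ^+ m.
Proof. by case/(sq_and_adj x n) => -> _ _; rewrite horner_poly. Qed.

End GegenbauerSquare.

(** * The coefficient identities *)

Section Combinatorics.
Variable R : realType.
Implicit Types (l x : R).

Let fact_neq0 k : k`!%:R != 0 :> R.
Proof. by rewrite pnatr_eq0 -lt0n fact_gt0. Qed.

(* [1 / (n - j)!], read as zero when [j > n]. *)
Definition rfact n j : R := if (j <= n)%N then ((n - j)`!%:R)^-1 else 0.

Lemma rfactSr n j : rfact n j.+1 = (n%:R - j%:R) * rfact n j.
Proof.
rewrite /rfact; case: ltngtP => [jn|jn|->].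
- rewrite -natrB ?(ltnW jn)// (_ : (n - j)%N = (n - j.+1).+1); last first.
    by rewrite subnS prednK// subn_gt0.
  have := fact_neq0 (n - j.+1) => ?.
  by rewrite factS natrM; field; apply/andP; split=> //; rewrite nat1r pnatr_eq0.
- by rewrite mulr0.
- by rewrite subrr mul0r.
Qed.

Lemma rfactSS n j : rfact n.+1 j.+1 = rfact n j.
Proof. by rewrite /rfact ltnS subSS. Qed.

Lemma rfactSl n j : rfact n j = (n.+1%:R - j%:R) * rfact n.+1 j.
Proof. by rewrite -rfactSr rfactSS. Qed.

Lemma shifted_factD l i j :
  shifted_fact l (i + j) = shifted_fact l i * shifted_fact (l + i%:R) j.
Proof.
elim: j => [|j IH]; first by rewrite addn0 shifted_fact0 mulr1.
by rewrite addnS !shifted_factS IH natrD; ring.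
Qed.

Lemma shifted_fact_nat a j : shifted_fact (a.+1%:R : R) j = (a + j)`!%:R / a`!%:R.
Proof.
elim: j => [|j IH]; first by rewrite addn0 shifted_fact0 divff.
rewrite shifted_factS IH addnS factS natrM -(addSn a j) natrD; ring.
Qed.

Lemma fact_double j : (j.*2)`!%:R = 4 ^+ j * j`!%:R * shifted_fact 2^-1 j :> R.
Proof.
elim: j => [|j IH]; first by rewrite double0 shifted_fact0 expr0 !mul1r.
rewrite doubleS !factS !natrM IH shifted_factS exprS.
rewrite -muln2 -2!natr1 natrM -natr1; by field.
Qed.

Lemma fact_doubleS j :
  (j.*2.+1)`!%:R = 4 ^+ j * j`!%:R * shifted_fact (1 + 2^-1) j :> R.
Proof.
elim: j => [|j IH]; first by rewrite double0 shifted_fact0 expr0 !mul1r.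
rewrite doubleS (factS j.*2.+2) (factS j.*2.+1) 2!natrM IH (factS j) natrM shifted_factS exprS.
rewrite -muln2 -3!natr1 natrM -natr1; by field.
Qed.

(** Up to a factor independent of [i], the term of the very-well-poised 5F4 at 1 with a = k + 1/2
    and parameters 1/2, -M/2, (1 - M)/2; the last two are merged in [rfact M i.*2], which ends the
    series at i = M/2. *)
Definition well_poised_term k M i : R := (4 * i%:R + 2 * k%:R + 1) * shifted_fact 2^-1 i * shifted_fact 2^-1 (i + k) /
   (i`!%:R * (i + k)`!%:R * (M + i.*2 + k.*2).+1`!%:R) * rfact M i.*2.

Local Notation f := well_poised_term.

(* Zeilberger's method: both sides satisfy the same first-order recurrence in [M], the
   left one because [f M.+1 i - rho M * f M i] is the difference [g i.+1 - g i]. *)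
Lemma well_poised_sum k M N : (M < N)%N ->
  \sum_(i < N) f k M i = shifted_fact 2^-1 (M + k) /
     ((M + k)`!%:R * M`!%:R * (M + k.*2)`!%:R).
Proof.
elim: M => [|M IH] MN.
  case: N MN => // N _; rewrite big_ord_recl big1 ?addr0 => [|i _]; last first.
    by rewrite /well_poised_term /rfact /bump/= mulr0.
  rewrite /well_poised_term /rfact /= double0 !add0n subn0 shifted_fact0 fact0.
  have := fact_neq0 k; have := fact_neq0 k.*2 => ? ?.
  have k0 : 0 <= k%:R :> R by [].
  have -> : (k.*2.+1)`!%:R = (2 * k%:R + 1) * (k.*2)`!%:R :> R.
    by rewrite factS natrM -(natr1 k.*2) -muln2 natrM mulrC [_ * 2]mulrC mulrC.
  field; repeat (apply/andP; split => //); lra.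
(* The quotient of the right-hand sides at [M.+1] and at [M]. *)
set rho : R := (M%:R + k%:R + 2^-1) / ((M%:R + k%:R + 1) * (M%:R + 1) * (M%:R + 2 * k%:R + 1)).
(* Common unit: both values of [f], [g i] and [g i.+1] are rational multiples of [h i], so checking
   the certificate is a rational identity. *)
pose h i := shifted_fact 2^-1 i * shifted_fact 2^-1 (i + k) /
   (i`!%:R * (i + k)`!%:R * (M + i.*2 + k.*2).+2`!%:R) * rfact M.+1 i.*2.
pose kap : R := -2 / ((M%:R + 1) * (M%:R + k%:R + 1) * (M%:R + 2 * k%:R + 1)).
pose g i := kap * i%:R * (i%:R + k%:R) * (M%:R + 2 * i%:R + 2 * k%:R + 2) *
   (M%:R + 2 * i%:R + 2 * k%:R + 1) * h i.
have M0 : 0 <= M%:R :> R by [].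
have k0 : 0 <= k%:R :> R by [].
have d1 : M%:R + k%:R + 1 != 0 :> R by lra.
have d2 : M%:R + 2 * k%:R + 1 != 0 :> R by lra.
have d3 : M%:R + 1 != 0 :> R by lra.
have fg i : f k M.+1 i - rho * f k M i = g i.+1 - g i.
  have i0 : 0 <= i%:R :> R by [].
  have -> : f k M.+1 i = (4 * i%:R + 2 * k%:R + 1) * h i.
    by rewrite /well_poised_term /h !addSn; ring.
  have := fact_neq0 i; have := fact_neq0 (i + k); have := fact_neq0 (M + i.*2 + k.*2).+1 => ? ? ?.
  have d4 : M%:R + 2 * i%:R + 2 * k%:R + 2 != 0 :> R by lra.
  have -> : f k M i = (4 * i%:R + 2 * k%:R + 1) * (M%:R + 2 * i%:R + 2 * k%:R + 2) *
      (M%:R + 1 - 2 * i%:R) * h i.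
    rewrite /well_poised_term /h rfactSl (factS (M + i.*2 + k.*2).+1) natrM.
    have -> : (M + i.*2 + k.*2).+2%:R = M%:R + 2 * i%:R + 2 * k%:R + 2 :> R.
      by rewrite -!muln2 -2!natr1 !natrD !natrM; ring.
    rewrite -(natr1 M) -[in rfact _ _]muln2 -muln2 natrM; field.
    by repeat (apply/andP; split => //).
  have -> : g i.+1 = kap * (i%:R + 2^-1) * (i%:R + k%:R + 2^-1) * (M%:R + 1 - 2 * i%:R) *
      (M%:R - 2 * i%:R) * h i.
    rewrite /g /h doubleS !rfactSr addSn !shifted_factS !addnS !addSn.
    rewrite (factS i) (factS (i + k)) (factS (M + i.*2 + k.*2).+3) (factS (M + i.*2 + k.*2).+2) !natrM.
    have -> : (M + i.*2 + k.*2).+4%:R = M%:R + 2 * i%:R + 2 * k%:R + 4 :> R.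
      by rewrite -!muln2 -4!natr1 !natrD !natrM; ring.
    have -> : (M + i.*2 + k.*2).+3%:R = M%:R + 2 * i%:R + 2 * k%:R + 3 :> R.
      by rewrite -!muln2 -3!natr1 !natrD !natrM; ring.
    have := fact_neq0 (M + i.*2 + k.*2).+2 => ?.
    have d5 : M%:R + 2 * i%:R + 2 * k%:R + 3 != 0 :> R by lra.
    have d6 : M%:R + 2 * i%:R + 2 * k%:R + 4 != 0 :> R by lra.
    have d7 : i%:R + 1 != 0 :> R by lra.
    have d8 : i%:R + k%:R + 1 != 0 :> R by lra.
    rewrite -(natr1 M) -(natr1 i) -(natr1 (i + k)) -(natr1 i.*2) natrD.
    have -> : i.*2%:R = 2 * i%:R :> R by rewrite -muln2 natrM mulrC.
    by rewrite /kap; field; repeat (apply/andP; split => //).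
  rewrite /g /rho /kap; field.
  by repeat (apply/andP; split => //).
have tel : \sum_(i < N) (f k M.+1 i - rho * f k M i) = 0.
  under eq_bigr do rewrite fg.
  (* [g 0] vanishes by its factor [i], and [g N] because [N.*2] exceeds [M.+1], where [rfact] is
     zero. *)
  rewrite -(big_mkord xpredT (fun i => g i.+1 - g i)) telescope_sumr// /g /h /rfact.
  rewrite [(N.*2 <= _)%N](_ : _ = false); first by rewrite !(mulr0, mul0r) subr0.
  by apply/negbTE; rewrite -ltnNge -addnn; apply: (leq_trans MN); rewrite leq_addr.
move: tel; rewrite sumrB -mulr_sumr IH 1?ltnW// => /eqP; rewrite subr_eq0 => /eqP ->.
have := fact_neq0 (M + k); have := fact_neq0 (M + k.*2); have := fact_neq0 M => ? ? ?.
rewrite !addSn !factS !natrM shifted_factS.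
rewrite -(natr1 (M + k)) -(natr1 (M + k.*2)) -(natr1 M) !natrD -muln2 natrM /rho; field.
by repeat (apply/andP; split => //).
Qed.


(** This is (-1)^m C(2m+2k, m) C(n+2k+m+1, 2m+2k+1) with (2m+2k)! cancelled. *)
Definition weinstein_coef k n m : R :=
  (-1) ^+ m * (n + k.*2 + m).+1`!%:R * rfact n m /
  (m`!%:R * (m + k.*2)`!%:R * (2 * m%:R + 2 * k%:R + 1)).

Let shifted_fact_neq0 (l : R) j : 0 < l -> shifted_fact l j != 0.
Proof. by move=> l0; rewrite gt_eqF// shifted_fact_gt0. Qed.

Lemma shifted_fact_half_succ j :
  shifted_fact (1 + 2^-1) j = (2 * j%:R + 1) * shifted_fact 2^-1 j :> R.
Proof.
elim: j => [|j IH]; first by rewrite !shifted_fact0 mulr0n mulr0 add0r mulr1.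
by rewrite !shifted_factS IH -(natr1 j); field.
Qed.

(** Spelled as in the theorem, so that it can be folded there. *)
Definition legendre_weight k n j : R :=
  (2 * j + 2 * k + 1)%:R *
  (4 ^+ (j + 2 * k) * (((j + k)`!)%:R) ^+ 2 * ((n - j)`!)%:R * (j`!)%:R
    * (shifted_fact (2^-1 : R) k) ^+ 2
   / (((2 * k + n + j + 1)`!)%:R * ((j + 2 * k)`!)%:R)).

(** Isolates the dependence on [i] in [f k m i]. The duplication formulas turn (2i)! and (2i+2k)!
    into half-integer shifted factorials, and the powers of 4 in the weight cancel. *)
Lemma legendre_term k n m i : (i.*2 <= m)%N -> (m <= n)%N ->
  legendre_weight k n i.*2 * (gegenbauer (k%:R + 2^-1) i.*2 0) ^+ 2 *
    gegenbauer_sq_coef (i.*2 + k + 1)%:R (n - i.*2) (m - i.*2) =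
  (-1) ^+ m * (n + k.*2 + m).+1`!%:R * rfact n m * ((m + k)`!%:R / shifted_fact (1 + 2^-1) (m + k)) *
  f k m i.
Proof.
move=> im mn; rewrite /gegenbauer_sq_coef leq_sub2r//.
(* Writing m = p + 2i and n = r + p + 2i removes all truncated subtractions. *)
pose p := (m - i.*2)%N; pose r := (n - m)%N.
have em : m = (p + i.*2)%N by rewrite subnK.
have en : n = (r + p + i.*2)%N by rewrite -addnA -em subnK.
rewrite {}en {}em {im mn}; move: p r => p r {n m}.
rewrite /legendre_weight /well_poised_term /rfact gegenbauer_even_at0 !addnK leq_add2r leq_addl leq_addl.
have -> : (r + p + i.*2 - (p + i.*2) = r)%N by rewrite subnDr addnK.
rewrite exprMn exprVn exprMn sqrr_sign mul1r.
have -> : (2 * (i.*2 + k + 1)%:R : R) = ((i.*2 + k).*2.+1).+1%:R.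
  by rewrite -natrM addn1 mul2n doubleS.
rewrite !shifted_fact_nat (addn1 (i.*2 + k)) shifted_fact_nat.
(* Clausen's factor (l + 1/2)_p with l = j + k + 1 is a tail of (3/2)_{m+k}, which is the constant
   to be split off. *)
have half2 : shifted_fact ((i.*2 + k).+1%:R + 2^-1) p =
   shifted_fact (1 + 2^-1) (i.*2 + k + p) / shifted_fact (1 + 2^-1) (i.*2 + k) :> R.
  rewrite shifted_factD mulrAC divff; first by rewrite mul1r -(natr1 (i.*2 + k)); congr shifted_fact; ring.
  by rewrite shifted_fact_neq0// addr_gt0.
have half3 : shifted_fact 2^-1 (i + k) = shifted_fact 2^-1 k * shifted_fact (k%:R + 2^-1) i :> R.
  by rewrite addnC shifted_factD addrC.
rewrite half2 half3.
have ? : shifted_fact 2^-1 k != 0 :> R by exact: shifted_fact_neq0.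
have ? : shifted_fact 2^-1 i != 0 :> R by exact: shifted_fact_neq0.
have ? : shifted_fact (k%:R + 2^-1) i != 0 :> R by rewrite shifted_fact_neq0// ltr_wpDl.
have ? : shifted_fact (1 + 2^-1) (i.*2 + k) != 0 :> R by rewrite shifted_fact_neq0// addr_gt0.
have ? : shifted_fact (1 + 2^-1) (i.*2 + k + p) != 0 :> R by rewrite shifted_fact_neq0// addr_gt0.
rewrite [(i.*2)`!%:R]fact_double.
rewrite (_ : (i.*2 + 2 * k)%N = (i + k).*2); last by rewrite doubleD mul2n.
rewrite [((i + k).*2)`!%:R]fact_double half3.
rewrite [((i.*2 + k).*2.+1)`!%:R]fact_doubleS.
rewrite (_ : (2 * k + (r + p + i.*2) + i.*2 + 1)%N = ((i.*2 + k).*2.+1 + (r + p))%N); last lia.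
rewrite (_ : ((i.*2 + k).*2.+1 + (r + p + p))%N = (r + p + i.*2 + k.*2 + (p + i.*2)).+1); last lia.
rewrite (_ : ((i.*2 + k).*2.+1 + p)%N = (p + i.*2 + i.*2 + k.*2).+1); last lia.
rewrite (_ : (p + i.*2 + k)%N = (i.*2 + k + p)%N); last lia.
rewrite (_ : (2 * i.*2 + 2 * k + 1)%:R = 4 * i%:R + 2 * k%:R + 1 :> R); last first.
  by rewrite -mul2n 2!natrD !natrM; ring.
rewrite [(-1) ^+ (p + i.*2)]exprD (_ : (-1) ^+ i.*2 = 1 :> R); last by rewrite -signr_odd odd_double.
rewrite (_ : 4 ^+ (i + k).*2 = (4 ^+ i * 4 ^+ k) ^+ 2 :> R); last by rewrite -muln2 exprM exprD.
rewrite (_ : 4 ^+ (i.*2 + k) = (4 ^+ i) ^+ 2 * 4 ^+ k :> R); last by rewrite exprD -muln2 exprM.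
rewrite (exprD 4 i k) mulr1.
have p4 j : 4 ^+ j != 0 :> R by rewrite expf_neq0.
have := fact_neq0 (i.*2 + k); have := fact_neq0 (i.*2 + k + p); have := fact_neq0 i.
have := fact_neq0 (i + k); have := fact_neq0 (r + p); have := fact_neq0 r; have := fact_neq0 p.
have := fact_neq0 ((i.*2 + k).*2.+1 + (r + p)); have := p4 i; have := p4 k.
have := fact_neq0 (p + i.*2 + i.*2 + k.*2).+1.
move: (4 ^+ i) (4 ^+ k) => p4i p4k *.
by field; repeat (apply/andP; split => //).
Qed.

Lemma sum_even_support (F : nat -> R) N :
  \sum_(j < N.*2) (if odd j then 0 else F j./2) = \sum_(i < N) F i.
Proof.
elim: N => [|N IH]; first by rewrite double0 !big_ord0.
by rewrite doubleS !big_ord_recr/= IH odd_double/= doubleK addr0.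
Qed.

Lemma well_poised_term_gt k m i : (m < i.*2)%N -> f k m i = 0.
Proof. by move=> mi; rewrite /well_poised_term /rfact leqNgt mi/= mulr0. Qed.

Lemma legendre_coef k n m : (m <= n)%N ->
  \sum_(j < n.+1 | (j <= m)%N) legendre_weight k n j * (gegenbauer (k%:R + 2^-1) j 0) ^+ 2 *
    gegenbauer_sq_coef (j + k + 1)%:R (n - j) (m - j) = weinstein_coef k n m.
Proof.
move=> mn.
pose X : R := (-1) ^+ m * (n + k.*2 + m).+1`!%:R * rfact n m *
  ((m + k)`!%:R / shifted_fact (1 + 2^-1) (m + k)).
transitivity (\sum_(j < n.+1) (if odd j then 0 else X * f k m j./2)).
  rewrite big_mkcond/=; apply: eq_bigr => j _.
  case: ifPn => [jm|]; last first.
    rewrite -ltnNge => mj; case: ifPn => // /even_halfK ej.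
    by rewrite well_poised_term_gt ?mulr0// ej.
  case: ifPn => oj; last first.
    by rewrite -{1 2 3 4 5}[nat_of_ord j](even_halfK oj) legendre_term// even_halfK.
  have ej : nat_of_ord j = (j./2.*2).+1 by rewrite odd_halfK// prednK// odd_gt0.
  by rewrite [X in gegenbauer _ X]ej gegenbauer_odd_at0 expr0n mulr0 mul0r.
have nn : (n.+1 <= n.+1.*2)%N by rewrite -addnn leq_addr.
rewrite (big_ord_widen _ (fun j => if odd j then 0 else X * f k m j./2) nn) big_mkcond/=.
(* Doubling the range adds only zeros: an even j > n >= m lies beyond the end of the well-poised
   series. *)
transitivity (\sum_(j < n.+1.*2) (if odd j then 0 else X * f k m j./2)).
  apply: eq_bigr => j _; case: ltnP => // nj; case: ifPn => // /even_halfK ej.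
  by rewrite well_poised_term_gt ?mulr0// ej (leq_ltn_trans mn).
rewrite (sum_even_support (fun i => X * f k m i)) -mulr_sumr well_poised_sum ?ltnS//.
rewrite /X shifted_fact_half_succ /weinstein_coef natrD.
have := fact_neq0 m; have := fact_neq0 (m + k); have := fact_neq0 (m + k.*2) => ? ? ?.
have ? : shifted_fact 2^-1 (m + k) != 0 :> R by exact: shifted_fact_neq0.
have m0 : 0 <= m%:R :> R by [].
have k0 : 0 <= k%:R :> R by [].
have d : 2 * m%:R + 2 * k%:R + 1 != 0 :> R by lra.
by field; repeat (apply/andP; split => //).
Qed.

Lemma sum_shift (F : nat -> R) n j : (j <= n)%N ->
  \sum_(m < (n - j).+1) F m = \sum_(m < n.+1 | (j <= m)%N) F (m - j)%N.
Proof.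
move=> jn; rewrite -(big_geq_mkord j n.+1 xpredT (fun m => F (m - j)%N)).
rewrite -[X in _ = \sum_(X <= _ < _) _]add0n big_addn big_mkord subSn//.
by apply: eq_bigr => i _; rewrite addnK.
Qed.

(** Clausen's formula contributes s^(m-j) and the prefactor s^j; exchanging the sums collects the
    coefficient found in [legendre_coef]. *)
Lemma legendre_sum k n (y : R) :
  \sum_(j < n.+1) legendre_weight k n j * (1 - y ^+ 2) ^+ j *
    (gegenbauer (k%:R + 2^-1) j 0) ^+ 2 * (gegenbauer (j + k + 1)%:R (n - j) y) ^+ 2 =
  \sum_(m < n.+1) weinstein_coef k n m * (1 - y ^+ 2) ^+ m.
Proof.
have coefE (m : 'I_n.+1) : weinstein_coef k n m * (1 - y ^+ 2) ^+ m =
    \sum_(j < n.+1 | (j <= m)%N) legendre_weight k n j * (gegenbauer (k%:R + 2^-1) j 0) ^+ 2 *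
      gegenbauer_sq_coef (j + k + 1)%:R (n - j) (m - j) * (1 - y ^+ 2) ^+ m.
  by rewrite -legendre_coef ?mulr_suml// -ltnS.
rewrite [RHS](eq_bigr _ (fun m _ => coefE m)).
rewrite (exchange_big_dep predT)//=; apply: eq_bigr => j _.
have jn : (j <= n)%N by rewrite -ltnS.
rewrite [gegenbauer (j + k + 1)%:R _ _ ^+ 2]gegenbauer_sqE; last by rewrite ltr0n addn1.
rewrite mulr_sumr (sum_shift (fun m => _ * (gegenbauer_sq_coef _ _ m * _ ^+ m)) jn).
apply: eq_bigr => m jm; rewrite -[in RHS](subnKC jm) exprD addKn; ring.
Qed.

(** * Partial sums of Jacobi polynomials *)

Lemma shifted_factN j m :
  shifted_fact (- j%:R : R) m = (-1) ^+ m * j`!%:R * rfact j m.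
Proof.
elim: m => [|m IH].
  by rewrite shifted_fact0 expr0 mul1r /rfact subn0 divff.
by rewrite shifted_factS IH rfactSr exprS; ring.
Qed.

(** The hockey-stick identity for C(j+2k+m, 2m+2k), multiplied by (2m+2k)!. *)
Lemma sum_jacobi_coef k n m :
  \sum_(j < n.+1) (j + k.*2 + m)`!%:R * rfact j m =
  (n + k.*2 + m).+1`!%:R * rfact n m / (2 * m%:R + 2 * k%:R + 1).
Proof.
have m0 : 0 <= m%:R :> R by [].
have k0 : 0 <= k%:R :> R by [].
have d : 2 * m%:R + 2 * k%:R + 1 != 0 :> R by lra.
elim: n => [|n IH].
  rewrite big_ord_recl big_ord0 addr0 /rfact; case: m {m0} d => [|m] d; last by rewrite !mulr0 mul0r.
  rewrite /= !add0n addn0 subn0 factS natrM -(natr1 k.*2) -muln2 natrM; field.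
  by apply/andP; split => //; lra.
rewrite big_ord_recr/= IH rfactSl !addSn (factS (n + k.*2 + m).+1) natrM.
rewrite -(natr1 (n + k.*2 + m).+1) -(natr1 (n + k.*2 + m)) !natrD -muln2 natrM -(natr1 n); field.
exact: d.
Qed.

Lemma jacobi_sum k n x :
  \sum_(j < n.+1) jacobi ((2 * k)%:R) 0 j x =
  \sum_(m < n.+1) weinstein_coef k n m * ((1 - x) / 2) ^+ m.
Proof.
set s := (1 - x) / 2.
have jE j : (j < n.+1)%N -> jacobi ((2 * k)%:R) 0 j x =
    \sum_(m < n.+1) (-1) ^+ m * ((j + k.*2 + m)`!%:R * rfact j m) / (m`!%:R * (m + k.*2)`!%:R) * s ^+ m.
  move=> jn; rewrite /jacobi mulr_sumr.
  rewrite (big_ord_widen n.+1 (fun m => _ * (shifted_fact _ m * shifted_fact _ m / (shifted_fact _ m * m`!%:R) * s ^+ m)) jn).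
  rewrite big_mkcond/=; apply: eq_bigr => m _.
  rewrite shifted_factN /rfact ltnS; case: leqP => mj; last by rewrite !(mulr0, mul0r).
  rewrite addr0 mul2n -(natrD _ j) !natr1 !shifted_fact_nat.
  have := fact_neq0 j; have := fact_neq0 (j - m); have := fact_neq0 m.
  have := fact_neq0 (k.*2 + m); have := fact_neq0 k.*2; have := fact_neq0 (j + k.*2) => ? ? ? ? ? ?.
  rewrite (addnC m k.*2) (addnC k.*2 j); field.
  by repeat (apply/andP; split => //).
rewrite (eq_bigr _ (fun (j : 'I_n.+1) _ => jE j (ltn_ord j))) exchange_big/=; apply: eq_bigr => m _.
rewrite /weinstein_coef -mulr_suml -mulr_suml -mulr_sumr sum_jacobi_coef.
rewrite !invfM; ring.
Qed.

End Combinatorics.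

(** * The expansion of the Weinstein functions *)

Section KoebeSeries.
Local Open Scope classical_set_scope.
Variable K : numFieldType.

Let smooth_onem n : smooth0 n (fun z : K => 1 - z).
Proof. by apply: smooth0B; [exact: smooth0_cst | exact: smooth0_id]. Qed.

Let onem0 : (fun z : K => 1 - z) 0 != 0. Proof. by rewrite /= subr0 oner_eq0. Qed.

Let smooth_geom p n : smooth0 n (fun z : K => (1 - z)^-1 ^+ p).
Proof. by apply: smooth0X; exact: smooth0V. Qed.

(** Pascal's rule, read off from (1-z)^(-p-2) = (1-z)^(-p-1) + z (1-z)^(-p-2). *)
Lemma taylor_coef_geom p n :
  taylor_coef (fun z : K => (1 - z)^-1 ^+ p.+1) n = 'C(n + p, p)%:R.
Proof.
elim: p n => [|p IHp]; elim=> [|n IHn].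
- by rewrite taylor_coef0 subr0 invr1 expr1n.
- have : taylor_coef (fun z : K => (1 - z)^-1 ^+ 1) n.+1 =
    taylor_coef (fun z : K => 1 + z * (1 - z)^-1 ^+ 1) n.+1.
    apply: taylor_coef_near_eq.
    by apply: filterS (smooth0_neq0 (smooth_onem 1) onem0) => z z1; rewrite expr1; field.
  rewrite taylor_coefD; [|exact: smooth0_cst|by apply: smooth0M => //; exact: smooth0_id].
  by rewrite taylor_coef_cst mul0r add0r taylor_coefXM// IHn !bin0 => ->.
- by rewrite taylor_coef0 subr0 invr1 expr1n add0n binn.
- have : taylor_coef (fun z : K => (1 - z)^-1 ^+ p.+2) n.+1 =
    taylor_coef (fun z : K => (1 - z)^-1 ^+ p.+1 + z * (1 - z)^-1 ^+ p.+2) n.+1.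
    apply: taylor_coef_near_eq.
    apply: filterS (smooth0_neq0 (smooth_onem 1) onem0) => z z1.
    by rewrite (exprS _ p.+1); field.
  rewrite taylor_coefD; [|exact: smooth_geom|by apply: smooth0M => //; exact: smooth0_id].
  rewrite taylor_coefXM// IHn IHp => ->.
  by rewrite -(addSnnS n p) (addnS n.+1 p) binS natrD addrC.
Qed.

Lemma smooth0_koebe n : smooth0 n (fun z : K => z / (1 - z) ^+ 2).
Proof.
apply: smooth0M; first exact: smooth0_id.
by apply: smooth0V; [exact: smooth0X | rewrite subr0 expr1n oner_eq0].
Qed.

Lemma taylor_coef_koebeX m n :
  taylor_coef (fun z : K => (z / (1 - z) ^+ 2) ^+ m.+1) n = 'C(n + m, m.*2.+1)%:R.
Proof.
rewrite (@taylor_coef_near_eq _ _ _ (fun z : K => z ^+ m.+1 * (1 - z)^-1 ^+ (m.*2.+1).+1)).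
  rewrite taylor_coefXnM//; case: ltnP => nm.
    by rewrite bin_small//; lia.
  by rewrite taylor_coef_geom; congr (_%:R); congr 'C(_, _); lia.
apply: nearW0 => z; rewrite exprMn -exprVn -exprM; congr (_ * _ ^+ _).
by rewrite mul2n doubleS.
Qed.

(** * The root of the Koebe equation, from a local square root of 1 + 4 z *)

Variable rho : K -> K.
Hypothesis rho0 : rho 0 = 1.
Hypothesis rho_derive : \forall z \near (0 : K), is_derive (z : K) 1 rho (2 / rho z).
Hypothesis rho_sq : \forall z \near (0 : K), rho z ^+ 2 = 1 + 4 * z.

Lemma smooth0_root n : smooth0 n rho.
Proof.
elim: n => [//|n IH]; apply: smooth0_intro rho_derive _.
apply: smooth0M; first exact: smooth0_cst.
by apply: smooth0V; rewrite ?rho0 ?oner_eq0.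
Qed.

Let two0 : 1 + 1 != 0 :> K. Proof. by rewrite -[1 + 1]/(2%:R) pnatr_eq0. Qed.

Let root1_neq0 : (fun z => rho z + 1) 0 != 0. Proof. by rewrite /= rho0. Qed.

Let smooth_root1 n : smooth0 n (fun z => rho z + 1).
Proof. by apply: smooth0D; [exact: smooth0_root | exact: smooth0_cst]. Qed.

(** For this w, 1 - w = 2 / (rho + 1), so w / (1 - w)^2 = (rho^2 - 1) / 4 = z. *)
Definition koebe_root z := (rho z - 1) / (rho z + 1).

Lemma smooth0_koebe_root n : smooth0 n koebe_root.
Proof.
apply: smooth0M; last by apply: smooth0V.
by apply: smooth0B; [exact: smooth0_root | exact: smooth0_cst].
Qed.

Definition koebe_root_term k z := koebe_root z ^+ k / rho z.

Lemma smooth0_koebe_root_term k n : smooth0 n (koebe_root_term k).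
Proof.
apply: smooth0M; first by apply: smooth0X; exact: smooth0_koebe_root.
by apply: smooth0V; rewrite ?rho0 ?oner_eq0//; exact: smooth0_root.
Qed.

Let root_neq0 : \forall z \near (0 : K), rho z != 0 /\ rho z + 1 != 0.
Proof.
apply: filterS2 (smooth0_neq0 (smooth0_root 1) _) (smooth0_neq0 (smooth_root1 1) root1_neq0) => //.
by rewrite rho0 oner_eq0.
Qed.

(** Since w = 4 z / (rho + 1)^2, w^k starts with z^k. This supplies the initial value: the factor
    (m+1)^2 - k^2 of the recurrence below vanishes at m + 1 = k. *)
Lemma taylor_coef_koebe_root_term_lt k m : (m <= k)%N ->
  taylor_coef (koebe_root_term k) m = (m == k)%:R.
Proof.
move=> mk.
rewrite (@taylor_coef_near_eq _ _ _
  (fun z => z ^+ k * ((4 / (rho z + 1) ^+ 2) ^+ k / rho z))); last first.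
  apply: filterS2 root_neq0 rho_sq => z [r0 r1] rz.
  rewrite /koebe_root_term mulrA -exprMn; congr (_ ^+ _ / _).
  rewrite (_ : z * _ = 4 * z / (rho z + 1) ^+ 2); last ring.
  rewrite (_ : 4 * z = (rho z - 1) * (rho z + 1)); first by rewrite /koebe_root; field.
  by rewrite -[4 * z](addKr 1) -rz; ring.
rewrite taylor_coefXnM; last first.
  move=> n; apply: smooth0M; last first.
    by apply: smooth0V; rewrite ?rho0 ?oner_eq0//; exact: smooth0_root.
  apply: smooth0X; apply: smooth0M; first exact: smooth0_cst.
  by apply: smooth0V; [exact: smooth0X | rewrite expf_neq0].
move: mk; rewrite leq_eqVlt => /predU1P[->|mk]; last by rewrite mk lt_eqF.
rewrite ltnn eqxx subnn taylor_coef0 rho0 invr1 mulr1.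
rewrite (_ : 4 / (1 + 1) ^+ 2 = 1) ?expr1n//; last by field.
Qed.

Let theta f : K -> K := fun z => z * derive1 f z.

Let taylor_coef_theta f m : (forall n, smooth0 n f) ->
  taylor_coef (theta f) m = m%:R * taylor_coef f m.
Proof.
move=> sf; have sf' n : smooth0 n (derive1 f) by case: (sf n.+1).
case: m => [|m]; first by rewrite taylor_coef0 /theta !mul0r.
by rewrite taylor_coefXM// taylor_coef_derive.
Qed.

(* With [v = koebe_root ^+ k] and [u = v / rho], the Euler operator [theta = z d/dz] satisfies
   [theta v = k u] and [(1 + 4 z) theta u = k v - 2 z u]. *)
Lemma taylor_coef_koebe_root_term_rec k m :
  (m.+1%:R ^+ 2 - k%:R ^+ 2) * taylor_coef (koebe_root_term k) m.+1 =
  - (m.+1%:R * (4 * m%:R + 2)) * taylor_coef (koebe_root_term k) m.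
Proof.
set u := koebe_root_term k; pose v z := koebe_root z ^+ k.
have su n : smooth0 n u by exact: smooth0_koebe_root_term.
have sv n : smooth0 n v by apply: smooth0X; exact: smooth0_koebe_root.
have st f : (forall n, smooth0 n f) -> forall n, smooth0 n (theta f).
  move=> sf n; apply: smooth0M; first exact: smooth0_id.
  by case: (sf n.+1).
have root_derive : \forall z \near (0 : K),
    is_derive (z : K) 1 koebe_root (4 / (rho z * (rho z + 1) ^+ 2)).
  apply: filterS2 root_neq0 rho_derive => z [r0 r1] dr.
  have d1 : is_derive (z : K) 1 (fun z => rho z + 1) (2 / rho z).
    by apply: is_derive_eq; rewrite addr0.
  have d2 : is_derive (z : K) 1 (fun z => rho z - 1) (2 / rho z).
    by apply: is_derive_eq; rewrite subr0.
  by apply: is_derive_eq (is_derive1M d2 (is_derive1V d1 r1)) _; field; rewrite r0 r1.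
have Ev : \forall z \near (0 : K), theta v z = k%:R * u z.
  apply: filterS3 root_derive root_neq0 rho_sq => z dz [r0 r1] rz; rewrite /theta.
  case: k {su} @u @v {sv} => [|k] u v.
    by rewrite mul0r /v; have -> : (fun z => koebe_root z ^+ 0) = cst 1 by []; rewrite derive1_cst mulr0.
  have [_ dv] := is_derive1X k dz; rewrite derive1E dv /u /koebe_root_term (exprS _ k).
  have zE : z = (rho z ^+ 2 - 1) / 4 by rewrite rz; field.
  rewrite {1}zE; move: (koebe_root z ^+ k) => wk; rewrite /koebe_root; field.
  by rewrite r0.
have Eu : \forall z \near (0 : K),
    theta u z + 4 * (z * theta u z) = k%:R * v z + -2 * (z * u z).
  near=> z.
  have [r0 r1] : rho z != 0 /\ rho z + 1 != 0 by near: z; exact: root_neq0.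
  have rz : rho z ^+ 2 = 1 + 4 * z by near: z; exact: rho_sq.
  have dr : is_derive (z : K) 1 rho (2 / rho z) by near: z; exact: rho_derive.
  have dv : is_derive (z : K) 1 v (derive1 v z) by near: z; exact: smooth0_is_derive (sv 1).
  have Evz : theta v z = k%:R * u z by near: z; exact: Ev.
  have [_ du] := is_derive1M dv (is_derive1V dr r0).
  have -> : theta u z = theta v z / rho z - 2 * z * v z / rho z ^+ 3.
    by rewrite /theta derive1E du; field.
  rewrite Evz; apply/eqP; rewrite -subr_eq0; apply/eqP.
  transitivity ((rho z ^+ 2) * (k%:R * u z / rho z - 2 * z * v z / rho z ^+ 3) -
    (k%:R * v z + -2 * (z * u z))); first by rewrite rz; ring.
  by rewrite /u /koebe_root_term -/(v z); field.
have := taylor_coef_near_eq m.+1 Ev; rewrite taylor_coef_theta// taylor_coefZ// => Tv.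
have := st u su; have := fun j => taylor_coef_theta j su.
move: (theta u) Eu => w Ew Tw sw.
have sz f n : (forall n, smooth0 n f) -> smooth0 n (fun z => z * f z).
  by move=> sf; apply: smooth0M => //; exact: smooth0_id.
have sc f c n : (forall n, smooth0 n f) -> smooth0 n (fun z => c * f z).
  by move=> sf; apply: smooth0M => //; exact: smooth0_cst.
have := taylor_coef_near_eq m.+1 Ew.
rewrite taylor_coefD//; last by apply: sc => n; exact: sz.
rewrite taylor_coefZ; last exact: sz.
rewrite taylor_coefD; [|exact: sc|by apply: sc => n; exact: sz].
rewrite taylor_coefZ// [X in _ = _ + X]taylor_coefZ; last exact: sz.
rewrite !taylor_coefXM// !Tw.
move: Tv; set vm := taylor_coef v _; set um := taylor_coef u m; set um1 := taylor_coef u m.+1.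
move=> Tv Tu.
(* The coefficient [vm] is eliminated by multiplying the second relation by [m.+1] and inserting the
   first. *)
transitivity (m.+1%:R * (m.+1%:R * um1 + 4 * (m%:R * um)) - k%:R * (k%:R * um1)
   - 4 * m.+1%:R * m%:R * um); first ring.
by rewrite Tu -Tv; ring.
Unshelve. all: by end_near. Qed.

(** From index k on, the factor of the recurrence is (j+1)(j+2k+1), never zero; the solution is
    (-1)^j C(2k+2j, j). *)
Lemma taylor_coef_koebe_root_term k j :
  taylor_coef (koebe_root_term k) (k + j) =
  (-1) ^+ j * ((k + j).*2)`!%:R / (j`!%:R * (j + k.*2)`!%:R).
Proof.
have fact_neq0 p : p`!%:R != 0 :> K by rewrite pnatr_eq0 -lt0n fact_gt0.
elim: j => [|j IH].
  by rewrite addn0 taylor_coef_koebe_root_term_lt// eqxx fact0 add0n !mul1r divff.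
have := taylor_coef_koebe_root_term_rec k (k + j); rewrite -addnS IH.
have j1 : j%:R + 1 != 0 :> K by rewrite natr1 pnatr_eq0.
have j2 : j%:R + k%:R * 2 + 1 != 0 :> K by rewrite -natrM -natrD natr1 pnatr_eq0.
rewrite (_ : (k + j.+1)%:R ^+ 2 - k%:R ^+ 2 = (j%:R + 1) * (j%:R + k%:R * 2 + 1) :> K); last first.
  by rewrite natrD -natr1; ring.
move=> E; apply: (mulfI (mulf_neq0 j1 j2)); rewrite E.
rewrite addnS doubleS (factS (k + j).*2.+1) (factS (k + j).*2) (factS j) addSn (factS (j + k.*2)) !natrM exprS.
rewrite -(natr1 (k + j).*2.+1) -(natr1 (k + j).*2) -(natr1 (k + j)) -(natr1 j) -(natr1 (j + k.*2)).
rewrite -!muln2 !natrD !natrM natrD.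
have := fact_neq0 j; have := fact_neq0 (j + k * 2)%N => ? ?.
by field; repeat (apply/andP; split => //).
Qed.

Lemma taylor_coef_koebe_flow_term k n s :
  taylor_coef (fun z => let W := s * (z / (1 - z) ^+ 2) in W * koebe_root_term k W) (k + n).+1 =
  s ^+ k.+1 * \sum_(m < n.+1) (-1) ^+ m * ((k + m).*2)`!%:R / (m`!%:R * (m + k.*2)`!%:R) *
     'C(n + k.*2 + m.+1, m.*2 + k.*2.+1)%:R * s ^+ m.
Proof.
pose F W := W * koebe_root_term k W.
pose G z := s * (z / (1 - z) ^+ 2).
have sF p : smooth0 p F.
  by apply: smooth0M; [exact: smooth0_id | exact: smooth0_koebe_root_term].
have sG p : smooth0 p G.
  by apply: smooth0M; [exact: smooth0_cst | exact: smooth0_koebe].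
rewrite (@taylor_coef_comp _ F G)//; last by rewrite /G mul0r mulr0.
rewrite big_ord_recl taylor_coef0 /F mul0r mul0r add0r.
(* [F] starts at order [k.+1], so the first [k] terms drop out. *)
rewrite -addnS big_split_ord/= big1 ?add0r => [|i _]; last first.
  rewrite /bump/= add1n taylor_coefXM; last exact: smooth0_koebe_root_term.
  by rewrite taylor_coef_koebe_root_term_lt ?(ltnW (ltn_ord i))// ltn_eqF// mul0r.
rewrite mulr_sumr; apply: eq_bigr => m _; rewrite /bump/= add1n taylor_coefXM; last exact: smooth0_koebe_root_term.
rewrite taylor_coef_koebe_root_term.
rewrite (@taylor_coef_near_eq _ _ _ (fun z => s ^+ (k + m).+1 * (z / (1 - z) ^+ 2) ^+ (k + m).+1)); last first.
  by apply: nearW0 => z; rewrite /G exprMn.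
rewrite taylor_coefZ; last by apply: smooth0X; exact: smooth0_koebe.
rewrite taylor_coef_koebeX -addSn exprD (_ : (k + n.+1 + (k + m))%N = (n + k.*2 + m.+1)%N); last lia.
rewrite (_ : (k + m).*2.+1 = (m.*2 + k.*2.+1)%N); last lia.
ring.
Qed.

End KoebeSeries.

(** * Differentiability of a branch of the square root *)

Section RootDerivative.
Local Open Scope classical_set_scope.
Variables (K : numFieldType) (f : K -> K) (r z : K).
Hypothesis r_gt0 : 0 < r.
Hypothesis f_sq : forall x, f x ^+ 2 = 1 + 4 * x.
Hypothesis f_ge : forall x, r <= `|f z + f x|.

Let f_diff x : (f z - f x) * (f z + f x) = 4 * (z - x).
Proof. by rewrite -subr_sqr !f_sq; ring. Qed.

Let f_sum_neq0 x : f z + f x != 0.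
Proof. by rewrite -normr_gt0; exact: lt_le_trans (f_ge x). Qed.

(** By [f_diff] and the lower bound, |f z - f x| <= (4 / r) |z - x|. *)
Lemma continuous_root : f x @[x --> z] --> f z.
Proof.
apply: (iffRL (@cvgrPdist_lt K K _ (nbhs z) _ f (f z))) => e e0.
near=> x.
have : `|z - x| < e * r / 4.
  by near: x; apply: cvgr_dist_lt => //; rewrite divr_gt0// mulr_gt0.
rewrite ltr_pdivlMr// => zx.
rewrite -(ltr_pM2r r_gt0); apply: le_lt_trans zx.
apply: (@le_trans _ _ (`|f z - f x| * `|f z + f x|)); first by rewrite ler_wpM2l.
by rewrite -normrM f_diff normrM mulrC (ger0_norm (ler0n _ 4)).
Unshelve. all: by end_near. Qed.

(** By [f_diff] the difference quotient is 4 / (f z + f x), which tends to 4 / (2 f z) by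
    continuity. *)
Lemma is_derive_root : is_derive (z : K) 1 f (2 / f z).
Proof.
have fz0 : f z != 0.
  by apply: contraTneq (f_sum_neq0 z) => ->; rewrite addr0 eqxx.
have E : (fun h => h^-1 *: ((f \o shift z) (h *: (1 : K)) - f z)) @ (0 : K)^' --> 2 / f z.
  rewrite (_ : 2 / f z = 4 / (f z + f z)); last by field; rewrite fz0 f_sum_neq0.
  have : (fun h => 4 / (f z + f (h + z))) @ (0 : K)^' --> 4 / (f z + f z).
    apply: cvgM; first exact: cvg_cst.
    apply: cvgV => //; apply: cvgD; first exact: cvg_cst.
    apply: cvg_within_filter.
    have := smooth0_continuous (smooth0D (smooth0_id _ 1) (smooth0_cst 1 z)).
    rewrite /prop_for /continuous_at add0r => cz.
    exact: (cvg_comp _ _ cz continuous_root).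
  apply: cvg_trans; apply: near_eq_cvg; near=> h.
  have h0 : h != 0 by near: h; exact: nbhs_dnbhs_neq.
  have := f_diff (h + z); have := f_sum_neq0 (h + z).
  rewrite /= /GRing.scale/= mulr1 => s0 D.
  apply: (mulfI h0); apply: (mulfI s0); rewrite mulVKf// mulrC [in RHS]mulrC.
  transitivity (4 * h); first by field.
  by rewrite -[LHS]opprK -mulrN (_ : - h = z - (h + z)) -?D; ring.
split; first by apply/cvg_ex; exists (2 / f z).
exact: cvg_lim.
Unshelve. all: by end_near. Qed.

End RootDerivative.

(** * The inverse Koebe function near 0 and the Weinstein functions *)

Section ComplexKoebe.
Local Open Scope classical_set_scope.
Variable R : realType.
Local Notation C := (R[i] : numFieldType).
Implicit Types z W : C.

Lemma Re_le_norm z : (complex.Re z)%:C <= `|z|.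
Proof.
apply: le_trans (normc_ge_Re z); rewrite lecR; exact: ler_norm.
Qed.

Lemma Re_sqrtc_ge0 z : 0 <= complex.Re (sqrtc z).
Proof. by case: z => a b /=; exact: sqrtr_ge0. Qed.

Lemma Re_sqrtc_gt0 z : 0 < complex.Re z -> 0 < complex.Re (sqrtc z).
Proof.
move=> z0; rewrite lt_neqAle Re_sqrtc_ge0 andbT; apply/eqP => r0.
have : 0 < complex.Re (sqrtc z ^+ 2) by rewrite sqr_sqrtc.
case: (sqrtc z) r0 => a b a0.
rewrite (_ : (a +i* b) ^+ 2 = (a * a - b * b) +i* (a * b + b * a)); last first.
  by rewrite exprS expr1; simpc.
by move: a0 => /= <- H; nra.
Qed.

Definition koebe_sqrt z : C := sqrtc (1 + 4 * z).

Lemma koebe_sqrt_sq z : koebe_sqrt z ^+ 2 = 1 + 4 * z.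
Proof. exact: sqr_sqrtc. Qed.

Lemma koebe_sqrt0 : koebe_sqrt 0 = 1.
Proof. by rewrite /koebe_sqrt mulr0 addr0 sqrtc1. Qed.

Lemma Re_1D4M z : complex.Re (1 + 4 * z) = 1 + 4 * complex.Re z.
Proof.
case: z => a b; rewrite (_ : 4 = 4%:C); last by rewrite rmorph_nat.
by rewrite /= mul0r subr0.
Qed.

Lemma Re_koebe_sqrt_gt0 : \forall z \near (0 : C), 0 < complex.Re (koebe_sqrt z).
Proof.
near=> z; apply: Re_sqrtc_gt0; rewrite Re_1D4M.
have z4 : `|z| < 4^-1 by near: z; exact: (cvgr0_norm_lt _ cvg_id).
have : (- complex.Re z)%:C < (4^-1)%:C.
  rewrite fmorphV rmorph_nat; apply: le_lt_trans z4; rewrite -normrN.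
  by apply: le_trans (Re_le_norm (- z)); case: (z).
rewrite ltcR; lra.
Unshelve. all: by end_near. Qed.

(** The bound is r = Re rho(z): the principal root has nonnegative real part at every x, so |rho(z)
    + rho(x)| >= r even across the branch cut. *)
Lemma koebe_sqrt_derive : \forall z \near (0 : C),
  is_derive (z : C) 1 koebe_sqrt (2 / koebe_sqrt z).
Proof.
apply: filterS Re_koebe_sqrt_gt0 => z.
set r := complex.Re _ => r0.
have r0C : 0 < r%:C by rewrite ltcR.
apply: (@is_derive_root _ koebe_sqrt r%:C) => // [x|x]; first exact: koebe_sqrt_sq.
apply: le_trans (Re_le_norm _); rewrite lecR.
rewrite /r; case: (koebe_sqrt z) (Re_sqrtc_ge0 (1 + 4 * x)) => a b.
by rewrite /koebe_sqrt; case: (sqrtc _) => c d /= ?; rewrite lerDl.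
Qed.


(** K(z) = K(w) amounts to (z - w)(1 - z w) = 0, and |z w| < 1 in the disk. *)
Lemma koebe_inj : {in @unit_disk R &, injective (@koebe R)}.
Proof.
move=> z w; rewrite !inE /unit_disk/= /koebe => z1 w1.
have ne1 (x : C) : `|x| < 1 -> 1 - x != 0.
  by apply: contraTneq => /eqP; rewrite subr_eq0 => /eqP <-; rewrite normr1 ltxx.
have zn := ne1 z z1; have wn := ne1 w w1.
have zwn : 1 - z * w != 0.
  by apply: ne1; rewrite normrM mulr_ilt1.
move=> E; apply/eqP; rewrite -subr_eq0; apply/eqP; apply: (mulIf zwn); rewrite mul0r.
transitivity ((z / (1 - z) ^+ 2 - w / (1 - w) ^+ 2) * ((1 - z) ^+ 2 * (1 - w) ^+ 2)).
  by field; rewrite zn wn.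
by rewrite E subrr mul0r.
Qed.

Local Notation root := (koebe_root (@koebe_sqrt)).

Lemma koebe_inv_root W : koebe_sqrt W + 1 != 0 -> `|root W| < 1 ->
  koebe_inv W = root W.
Proof.
move=> r1 w1; rewrite /koebe_inv.
rewrite -{1}(_ : koebe (root W) = W); last first.
  rewrite /koebe /koebe_root.
  transitivity ((koebe_sqrt W ^+ 2 - 1) / 4); last by rewrite koebe_sqrt_sq; field.
  field; rewrite r1 /=.
  by rewrite (_ : _ + 1 - (_ - 1) = 2 :> C) ?pnatr_eq0//; ring.
by apply: pinvKV; [exact: koebe_inj | rewrite inE].
Qed.

Let sq_near : \forall z \near (0 : C), koebe_sqrt z ^+ 2 = 1 + 4 * z.
Proof. by apply: nearW0 => z; exact: koebe_sqrt_sq. Qed.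

Lemma weinsteinE k n t :
  weinstein k (k + n) t = (expR t)%:C * taylor_coef (fun z : C =>
    let W := (expR (- t))%:C * (z / (1 - z) ^+ 2) in
    W * koebe_root_term (@koebe_sqrt) k W) (k + n).+1.
Proof.
pose F (W : C) := W * koebe_root_term (@koebe_sqrt) k W.
pose G (z : C) := (expR (- t))%:C * (z / (1 - z) ^+ 2).
have sroot p : smooth0 p root.
  exact: smooth0_koebe_root koebe_sqrt0 koebe_sqrt_derive _.
have sG p : smooth0 p G.
  by apply: smooth0M; [exact: smooth0_cst | exact: smooth0_koebe].
have G0 : G 0 = 0 by rewrite /G mul0r mulr0.
have sF p : smooth0 p F.
  apply: smooth0M; first exact: smooth0_id.
  exact: smooth0_koebe_root_term koebe_sqrt0 koebe_sqrt_derive _ _.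
have ssqrt := smooth0_root koebe_sqrt0 koebe_sqrt_derive.
have n0 : \forall W \near (0 : C), koebe_sqrt W != 0.
  by apply: (smooth0_neq0 (ssqrt 1)); rewrite koebe_sqrt0 oner_eq0.
have n1 : \forall W \near (0 : C), koebe_sqrt W + 1 != 0.
  have s1 : smooth0 1 (fun W : C => koebe_sqrt W + 1).
    by apply: smooth0D; [exact: ssqrt | exact: smooth0_cst].
  by apply: (smooth0_neq0 s1); rewrite koebe_sqrt0 -[1 + 1]/(2%:R) pnatr_eq0.
have nw : \forall W \near (0 : C), `|root W| < 1.
  have := smooth0_continuous (sroot 1).
  rewrite /prop_for /continuous_at {2}/koebe_root koebe_sqrt0 subrr mul0r => c.
  exact: (cvgr0_norm_lt _ c).
(* Here 1 - w^2 = 4 rho / (rho + 1)^2, so w / (1 - w^2) = (rho^2 - 1) / (4 rho) = W / rho. *)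
have key : \forall W \near (0 : C),
    koebe_inv W ^+ k.+1 / (1 - koebe_inv W ^+ 2) = F W.
  apply: filterS3 n0 n1 nw => W W0 W1 w1; rewrite koebe_inv_root// exprS.
  rewrite /F /koebe_root_term; move: (root W ^+ k) => wk.
  have WE : W = (koebe_sqrt W ^+ 2 - 1) / 4 by rewrite koebe_sqrt_sq; field.
  rewrite [X in _ = X * _]WE /koebe_root; field; rewrite W0 W1 /=.
  rewrite (_ : (koebe_sqrt W + 1) ^+ 2 - (koebe_sqrt W - 1) ^+ 2 = 4 * koebe_sqrt W); last ring.
  by rewrite mulf_neq0// pnatr_eq0.
rewrite /weinstein -taylor_coefZ; last exact: (smooth0_comp (sF _) (sG _) G0).
apply: taylor_coef_near_eq; have := smooth0_comp_near (sG 1) G0 key.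
by apply: filterS => z kz; rewrite -mulrA; congr (_ * _); exact: kz.
Qed.

Lemma weinstein_sum k n t : weinstein k (k + n) t =
  (expR (- t) ^+ k * \sum_(m < n.+1) weinstein_coef R k n m * expR (- t) ^+ m)%:C.
Proof.
rewrite weinsteinE (taylor_coef_koebe_flow_term koebe_sqrt0 koebe_sqrt_derive sq_near).
rewrite rmorphM rmorphXn/= rmorph_sum/= mulrA exprS mulrA.
(* The factor e^t cancels one of the k + 1 factors e^(-t). *)
rewrite (_ : (expR t)%:C * (expR (- t))%:C = 1 :> R[i]) ?mul1r; last first.
  by rewrite -rmorphM/= -expRD subrr expR0.
congr (_ * _); apply: eq_bigr => m _.
have mn : (m <= n)%N by rewrite -ltnS.
have fact_neq0 p : p`!%:R != 0 :> C by rewrite pnatr_eq0 -lt0n fact_gt0.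
rewrite rmorphM/= rmorphXn/=; congr (_ * _).
rewrite /weinstein_coef /rfact mn (_ : 2 * m%:R + 2 * k%:R + 1 = (k + m).*2.+1%:R :> R); last first.
  by rewrite -(natr1 (k + m).*2) -mul2n natrM natrD; ring.
rewrite fmorph_div 4!rmorphM fmorphV rmorphXn rmorphN1/= !rmorph_nat.
have mk : (m.*2 + k.*2.+1 <= n + k.*2 + m.+1)%N by lia.
have := bin_fact mk; rewrite (_ : (n + k.*2 + m.+1 - (m.*2 + k.*2.+1) = n - m)%N); last lia.
rewrite addnS (_ : (m.*2 + k.*2.+1 = (k + m).*2.+1)%N); last lia.
rewrite (factS (k + m).*2) => /(congr1 (fun p => p%:R : C)); rewrite 3!natrM.
move=> <-.
have := fact_neq0 m; have := fact_neq0 (m + k.*2)%N; have := fact_neq0 (n - m)%N.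
have : (k + m).*2.+1%:R != 0 :> C by rewrite pnatr_eq0.
move: ((k + m).*2.+1%:R : C) => d ? ? ? ?.
by field; repeat (apply/andP; split => //).
Qed.

End ComplexKoebe.

Theorem mainTheorem1 (R : realType) (k n : nat) (t y : R) (ht : 0 <= t)
    (hy : y = Num.sqrt (1 - expR (- t))) :
  weinstein k (k + n) t =
    (\sum_(j < n.+1)
       (2 * j + 2 * k + 1)%:R *
       (4 ^+ (j + 2 * k) * (((j + k)`!)%:R) ^+ 2 * ((n - j)`!)%:R * (j`!)%:R
          * (shifted_fact (2^-1 : R) k) ^+ 2
        / (((2 * k + n + j + 1)`!)%:R * ((j + 2 * k)`!)%:R)) *
       expR (- ((j + k)%:R * t)) *
       (gegenbauer (k%:R + 2^-1 : R) j 0) ^+ 2 *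
       (gegenbauer ((j + k + 1)%:R : R) (n - j) (Num.sqrt (1 - expR (- t))))
         ^+ 2)%:C
  /\
  \sum_(j < n.+1) jacobi ((2 * k)%:R : R) 0 j (2 * y ^+ 2 - 1) =
    \sum_(j < n.+1)
      (2 * j + 2 * k + 1)%:R *
      (4 ^+ (j + 2 * k) * (((j + k)`!)%:R) ^+ 2 * ((n - j)`!)%:R * (j`!)%:R
         * (shifted_fact (2^-1 : R) k) ^+ 2
       / (((2 * k + n + j + 1)`!)%:R * ((j + 2 * k)`!)%:R)) *
      (1 - y ^+ 2) ^+ j *
      (gegenbauer (k%:R + 2^-1 : R) j 0) ^+ 2 *
      (gegenbauer ((j + k + 1)%:R : R) (n - j) y) ^+ 2.
Proof.
(* [ht] makes the radicand nonnegative, so squaring undoes the root. *)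
have es : expR (- t) = 1 - y ^+ 2.
  rewrite hy sqr_sqrtr ?subKr// subr_ge0 -expR0 ler_expR; lra.
split.
  rewrite weinstein_sum es -legendre_sum mulr_sumr; congr (_%:C).
  apply: eq_bigr => j _; rewrite -/(legendre_weight R k n j) -es -hy.
  by rewrite -mulrN expRM_natl exprD; ring.
(* The Jacobi variable (1 - x) / 2 becomes s, so the second identity again evaluates the polynomial
   with coefficients [weinstein_coef]. *)
rewrite jacobi_sum (_ : (1 - (2 * y ^+ 2 - 1)) / 2 = 1 - y ^+ 2); last by field.
by rewrite -legendre_sum.
Qed.
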